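(* Let $p$ be a prime, $n\ge1$, $s>0$ and $f\in\mathcal{S}(\mathbb{Q}_p^n)$. Let $\varphi$ be the solution (bounded and continuous on the end compactification of $\mathcal{T}_{p^n}$) of the Dirichlet problem \[\begin{cases}\Delta_w\varphi(v)=0,& v\in\mathcal{T}_{p^n};\\ \varphi|_{\partial\mathcal{T}_{p^n}}=f\end{cases}\] with $f(\infty)=0$. Then for every $k\in\mathbb{Z}$ the layer $\varphi_k$ has Fourier transform \[\hat\varphi_k(\boldsymbol{\xi})=\begin{cases}\hat f(\boldsymbol{\xi})\bigl(1-p^{-s(k+1)}\|\boldsymbol{\xi}\|_p^s\bigr),& k\ge -v_p(\boldsymbol{\xi});\\ 0,& k<-v_p(\boldsymbol{\xi}),\end{cases}\] where at $\boldsymbol{\xi}=\boldsymbol{0}$ the first line is understood as $\hat\varphi_k(\boldsymbol{0})=\hat f(\boldsymbol{0})$.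
   Context: For $\boldsymbol{x}\in\mathbb{Q}_p^n$: $\|\boldsymbol{x}\|_p=\max_i|x_i|_p$, $v_p(\boldsymbol{x})=\min_iv_p(x_i)$, $v_p(\boldsymbol{0})=+\infty$. $d\boldsymbol{x}$ is Haar measure with $|\mathbb{Z}_p^n|=1$. $\mathcal{S}(\mathbb{Q}_p^n)$ is the space of locally constant, compactly supported complex-valued functions. Fourier transform: $\hat f(\boldsymbol{\xi})=\int_{\mathbb{Q}_p^n}f(\boldsymbol{x})\chi_p(\boldsymbol{x}\cdot\boldsymbol{\xi})\,d\boldsymbol{x}$ with $\chi_p(x)=e^{2\pi i\{x\}_p}$. Tree: the vertices of $\mathcal{T}_{p^n}$ are the pairs $(\boldsymbol{x},k)$ with $k\in\mathbb{Z}$ and $\boldsymbol{x}\in\mathbb{Q}_p^n/p^k\mathbb{Z}_p^n$. Each $(\boldsymbol{x},k)$ is adjacent to its unique upper neighbor $(\boldsymbol{x},k-1)$ and to its $p^n$ lower neighbors $(\boldsymbol{x}+\boldsymbol{a}p^k,k+1)$, $\boldsymbol{a}\in\mathbb{F}_p^n$ (identified with $\{0,\dots,p-1\}^n$), and to no other vertex. The set of ends is $\partial\mathcal{T}_{p^n}=\mathbb{Q}_p^n\cup\{\infty\}$, where $\boldsymbol{x}$ is the end of the ray $((\boldsymbol{x},k))_{k\to+\infty}$ and $\infty$ is the common end of the upward rays $k\to-\infty$. For a function $\varphi$ on vertices, $\varphi_k(\boldsymbol{x})=\varphi(\boldsymbol{x},k)$, a function on $\mathbb{Q}_p^n$ constant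 on cosets of $p^k\mathbb{Z}_p^n$. The edge joining $(\boldsymbol{x},k-1)$ and $(\boldsymbol{x},k)$ has weight $w=p^{k(s-n)}$, and $\Delta_w\varphi(v)=\sum_{u\sim v}w_{uv}(\varphi(u)-\varphi(v))$. The boundary condition means: $\lim_{k\to+\infty}\varphi_k(\boldsymbol{x})=f(\boldsymbol{x})$ for $\boldsymbol{x}\in\mathbb{Q}_p^n$, and $\varphi(v)\to0$ along every sequence of vertices converging to the end $\infty$; both are end limits, i.e. $\varphi$ extends continuously to the end compactification $\mathcal{T}_{p^n}\cup\partial\mathcal{T}_{p^n}$ with boundary values $f$ on $\mathbb{Q}_p^n$ and $0$ at $\infty$. The bounded, end-continuous solution exists and is unique. *)

(* Defs.v *)
From HB Require Import structures.
From mathcomp Require Import all_boot all_order all_algebra.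
From mathcomp Require Import all_classical all_reals all_analysis.
From mathcomp Require Import complex ring.

Set Implicit Arguments.
Unset Strict Implicit.
Unset Printing Implicit Defensive.

Import Order.TTheory GRing.Theory Num.Theory numFieldNormedType.Exports.

Local Open Scope classical_set_scope.
Local Open Scope ring_scope.

Section RatNorm.
Variables (p : nat) (p_pr : prime p).
Implicit Types (a b c d : int) (x y : rat).

Definition rat_padic_val (x : rat) : int :=
  (logn p `|numq x|)%:Z - (logn p `|denq x|)%:Z.

Definition rat_padic_norm (x : rat) : rat :=
  if x == 0 then 0 else p%:Q ^ (- rat_padic_val x).

Local Notation nq := rat_padic_norm.

Let p_gt0 : 0 < p%:Q. Proof. by rewrite ltr0z; apply: prime_gt0. Qed.
Let p_neq0 : p%:Q != 0. Proof. by rewrite gt_eqF. Qed.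
Let p_gt1 : 1 < p%:Q. Proof. by rewrite (ltr_int _ 1); exact: prime_gt1. Qed.

Lemma rat_padic_norm0 : nq 0 = 0. Proof. by rewrite /rat_padic_norm eqxx. Qed.

Lemma rat_padic_norm_ge0 x : 0 <= nq x.
Proof. by rewrite /rat_padic_norm; case: eqP => // _; exact/exprz_ge0/ltW. Qed.

Lemma rat_padic_norm_eq0 x : (nq x == 0) = (x == 0).
Proof.
rewrite /rat_padic_norm; case: (eqVneq x 0) => [_|x0]; first by rewrite eqxx.
by apply/negbTE; rewrite expfz_neq0.
Qed.

Lemma rat_padic_norm_frac a b : a != 0 -> b != 0 ->
  nq (a%:Q / b%:Q) = p%:Q ^ ((logn p `|b|)%:Z - (logn p `|a|)%:Z).
Proof.
move=> a0 b0; set x := _ / _.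
have x0 : x != 0 by rewrite mulf_neq0 ?invr_eq0 ?intr_eq0.
rewrite /rat_padic_norm (negbTE x0) /rat_padic_val; congr (_ ^ _).
have E : a * denq x = numq x * b.
  apply/eqP; rewrite -(eqr_int rat) !intrM.
  by rewrite -eqr_div ?intr_eq0 ?denq_neq0 // divq_num_den.
have := congr1 (fun z : int => logn p `|z|) E.
rewrite !abszM !lognM ?absz_gt0 ?denq_neq0 ?numq_eq0 // => H.
by rewrite opprB; apply/eqP; rewrite subr_eq addrAC eq_sym subr_eq -!PoszD addnC [X in _ == X%:Z]addnC H.
Qed.

Lemma rat_padic_norm_int_le a b c : nq (a%:Q) <= nq (c%:Q) -> nq (b%:Q) <= nq (c%:Q) ->
  nq ((a + b)%:Q) <= nq (c%:Q).
Proof.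
have E a' : a' != 0 -> nq (a'%:Q) = p%:Q ^ (- (logn p `|a'|)%:Z).
  by move=> a0; rewrite -[a'%:Q]divr1 -[1]/(1%:Q) rat_padic_norm_frac// logn1 sub0r.
have [->|a0] := eqVneq a 0; first by rewrite add0r.
have [->|b0] := eqVneq b 0; first by rewrite addr0.
have [->|ab0] := eqVneq (a + b) 0; first by rewrite rat_padic_norm0 rat_padic_norm_ge0.
have [->|c0] := eqVneq c 0.
  by rewrite rat_padic_norm0 le_eqVlt rat_padic_norm_eq0 intr_eq0 (negbTE a0) ltNge rat_padic_norm_ge0.
rewrite !E // !(ler_eXz2l) // !lerN2 !lez_nat => ha hb.
rewrite -pfactor_dvdn ?absz_gt0 //.
rewrite -[(_ %| _)%N]/((p ^ logn p `|c|)%N%:Z %| (a + b))%Z.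
by apply: rpredD; rewrite dvdzE /= pfactor_dvdn ?absz_gt0.
Qed.

Lemma rat_padic_normM x y : nq (x * y) = nq x * nq y.
Proof.
have [->|x0] := eqVneq x 0; first by rewrite mul0r rat_padic_norm0 mul0r.
have [->|y0] := eqVneq y 0; first by rewrite mulr0 rat_padic_norm0 mulr0.
rewrite -[x]divq_num_den -[y]divq_num_den mulf_div -!intrM.
rewrite !rat_padic_norm_frac ?mulf_neq0 ?numq_eq0 ?denq_neq0 //.
rewrite -expfzDr // !abszM !lognM ?absz_gt0 ?numq_eq0 ?denq_neq0 // !PoszD.
by rewrite opprD addrACA.
Qed.

Lemma rat_padic_normN x : nq (- x) = nq x.
Proof.
rewrite -mulN1r rat_padic_normM -[-1]/((-1)%:Q) -[(-1)%:Q]divr1 -[1]/(1%:Q).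
by rewrite rat_padic_norm_frac //= logn1 subrr expr0z mul1r.
Qed.

Lemma rat_padic_normB x y : nq (x - y) = nq (y - x).
Proof. by rewrite -rat_padic_normN opprB. Qed.

Lemma rat_padic_norm1 : nq 1 = 1.
Proof.
by rewrite -[1]divr1 -[1]/(1%:Q) rat_padic_norm_frac //= logn1 subrr expr0z.
Qed.

Lemma rat_padic_normD x y : nq (x + y) <= Num.max (nq x) (nq y).
Proof.
have d0 z : (denq z)%:Q != 0 by rewrite intr_eq0 denq_neq0.
have H (c : rat) : nq x <= nq c -> nq y <= nq c -> nq (x + y) <= nq c.
  set D := (denq x * denq y * denq c)%:Q.
  have D0 : 0 < nq D.
    by rewrite lt_neqAle rat_padic_norm_ge0 eq_sym rat_padic_norm_eq0 /D !intrM !mulf_neq0.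
  have nE z : (numq z)%:Q = z * (denq z)%:Q by rewrite numqE.
  rewrite -(ler_pM2r D0 (nq x)) -(ler_pM2r D0 (nq y)) -(ler_pM2r D0 (nq (x + y))).
  rewrite -!rat_padic_normM.
  have -> : x * D = (numq x * denq y * denq c)%:Q by rewrite /D !intrM nE; ring.
  have -> : y * D = (numq y * denq x * denq c)%:Q by rewrite /D !intrM nE; ring.
  have -> : c * D = (numq c * denq x * denq y)%:Q by rewrite /D !intrM nE; ring.
  have -> : (x + y) * D = (numq x * denq y * denq c + numq y * denq x * denq c)%:Q.
    by rewrite intrD /D !intrM !nE; ring.
  exact: rat_padic_norm_int_le.
by case: (leP (nq x) (nq y)) => h; apply: H => //; exact: ltW.
Qed.

Lemma rat_padic_normD_lt x y e : nq x < e -> nq y < e -> nq (x + y) < e.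
Proof. by move=> xe ye; rewrite (le_lt_trans (rat_padic_normD _ _)) // gt_max xe. Qed.

Lemma rat_padic_norm_eq x y : nq y < nq x -> nq (x + y) = nq x.
Proof.
move=> yx; apply/le_anti/andP; split.
  by rewrite (le_trans (rat_padic_normD _ _)) // ge_max lexx ltW.
rewrite leNgt; apply/negP => h.
by have := rat_padic_normD_lt h; move=> /(_ (- y)); rewrite rat_padic_normN addrK ltxx => /(_ yx).
Qed.

End RatNorm.

Section PadicNumbers.
Variable p : nat.
Local Notation nq := (rat_padic_norm p).

(* Primality is not used by the condition itself: it is an argument so that the
   ring structures below can be inferred from the type of Cauchy sequences. *)
Definition padic_cauchy (_ : prime p) : pred (nat -> rat) := [pred u | `[<
  forall e : rat, 0 < e -> exists N, forall m n, (N <= m)%N -> (N <= n)%N ->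
    nq (u m - u n) < e >]].

Variable p_pr : prime p.

Lemma padic_cauchy_bounded u : (padic_cauchy p_pr) u ->
  exists M, 0 < M /\ forall n, nq (u n) < M.
Proof.
move/asboolP => /(_ 1 ltr01)[N uN].
exists (1 + \sum_(i < N.+1) nq (u i)); split=> [|n].
  by rewrite ltr_pwDl // sumr_ge0 // => i _; exact: rat_padic_norm_ge0.
have le_sum k : (k < N.+1)%N -> nq (u k) < 1 + \sum_(i < N.+1) nq (u i).
  move=> kN; rewrite (bigD1 (Ordinal kN)) //= addrCA ltrDl ltr_pwDl //.
  by rewrite sumr_ge0 // => i _; exact: rat_padic_norm_ge0.
have [nN|Nn] := ltnP n N.+1; first exact: le_sum.
rewrite -(subrK (u N) (u n)); apply: rat_padic_normD_lt => //; last exact: le_sum.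
rewrite (lt_le_trans (uN n N (ltnW Nn) (leqnn _))) // lerDl.
by rewrite sumr_ge0 // => i _; exact: rat_padic_norm_ge0.
Qed.

Lemma padic_cauchy_subring : subring_closed (padic_cauchy p_pr).
Proof.
split.
- apply/asboolP => e e0; exists 0%N => m n _ _.
  by rewrite [X in nq X]subrr rat_padic_norm0.
- move=> u v /asboolP uC /asboolP vC; apply/asboolP => e e0.
  have [N uN] := uC e e0; have [N' vN] := vC e e0.
  exists (maxn N N') => m n; rewrite !geq_max => /andP[m1 m2] /andP[n1 n2].
  rewrite [X in nq X](_ : _ = (u m - u n) + - (v m - v n)); last first.
    by rewrite -[(u - v) m]/(u m - v m) -[(u - v) n]/(u n - v n); ring.
  by apply: rat_padic_normD_lt => //; rewrite ?rat_padic_normN //; [exact: uN|exact: vN].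
- move=> u v uC vC; apply/asboolP => e e0.
  have [M [M0 uM]] := padic_cauchy_bounded uC.
  have [M' [M0' vM]] := padic_cauchy_bounded vC.
  move: uC vC => /asboolP uC /asboolP vC.
  have [N uN] := uC (e / M') (divr_gt0 e0 M0').
  have [N' vN] := vC (e / M) (divr_gt0 e0 M0).
  exists (maxn N N') => m n; rewrite !geq_max => /andP[m1 m2] /andP[n1 n2].
  rewrite [X in nq X](_ : _ = (u m - u n) * v m + u n * (v m - v n)); last first.
    by rewrite -[(u * v) m]/(u m * v m) -[(u * v) n]/(u n * v n); ring.
  apply: rat_padic_normD_lt => //; rewrite rat_padic_normM //.
    rewrite -[e](divfK (lt0r_neq0 M0')).
    by apply: ltr_pM; rewrite ?rat_padic_norm_ge0 //; exact: uN.
  rewrite -[e](divfK (lt0r_neq0 M0)) [X in _ < X]mulrC.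
  by apply: ltr_pM; rewrite ?rat_padic_norm_ge0 //; exact: vN.
Qed.
HB.instance Definition _ :=
  GRing.isSubringClosed.Build (nat -> rat) (padic_cauchy p_pr) padic_cauchy_subring.

Record padic_cauchy_seq := PadicCauchySeq {
  cauchy_term :> nat -> rat; _ : cauchy_term \in (padic_cauchy p_pr) }.
HB.instance Definition _ := [isSub for cauchy_term].
HB.instance Definition _ := [Choice of padic_cauchy_seq by <:].
HB.instance Definition _ := [SubChoice_isSubComNzRing of padic_cauchy_seq by <:].

Definition padic_null : pred padic_cauchy_seq := [pred u : padic_cauchy_seq | `[<
  forall e : rat, 0 < e -> exists N, forall n, (N <= n)%N -> nq (u n) < e >]].

Lemma padic_null_ideal : idealr_closed padic_null.
Proof.
split.
- by apply/asboolP => e e0; exists 0%N => n _; rewrite rat_padic_norm0.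
- apply/negP => /asboolP /(_ 1 ltr01)[N /(_ N (leqnn _))].
  by rewrite rat_padic_norm1 // ltxx.
- move=> a u v /asboolP uN /asboolP vN; apply/asboolP => e e0.
  have [M [M0 aM]] := padic_cauchy_bounded (valP a).
  have [N {}uN] := uN (e / M) (divr_gt0 e0 M0); have [N' {}vN] := vN e e0.
  exists (maxn N N') => n; rewrite !geq_max => /andP[n1 n2].
  rewrite -[(_ : padic_cauchy_seq) n]/(a n * u n + v n).
  apply: rat_padic_normD_lt => //; last exact: vN.
  rewrite rat_padic_normM // -[e](divfK (lt0r_neq0 M0)) [X in _ < X]mulrC.
  by apply: ltr_pM; rewrite ?rat_padic_norm_ge0 ?aM ?uN.
Qed.
HB.instance Definition _ :=
  isIdealr.Build padic_cauchy_seq padic_null padic_null_ideal.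

Definition padic_null_idealr : idealr padic_cauchy_seq := padic_null.

(* Q_p, the completion of Q for the p-adic absolute value: Cauchy sequences of
   rationals modulo null sequences. *)
Definition padic := {ideal_quot padic_null_idealr}.
HB.instance Definition _ := GRing.ComNzRing.on padic.
HB.instance Definition _ := isPointed.Build padic 0.

Local Notation cls u := (\pi_{ideal_quot padic_null_idealr}%qT u : padic).

Lemma padic_null_eq (u v : padic_cauchy_seq) :
  cls u = cls v <-> u - v \in padic_null.
Proof. by rewrite Quotient.idealrBE; split => [/eqP|/eqP]. Qed.

Lemma nonnull_norm (u : padic_cauchy_seq) : u \notin padic_null ->
  exists N, nq (u N) != 0 /\ forall n, (N <= n)%N -> nq (u n) = nq (u N).
Proof.
move/asboolPn/existsNP => [e /not_implyP[e0 /forallNP uN]].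
have /asboolP /(_ e e0)[N uC] := valP u.
have /existsNP [n /not_implyP[Nn /negP]] := uN N; rewrite -leNgt => eun.
exists n; split=> [|m nm]; first by rewrite gt_eqF // (lt_le_trans e0).
rewrite -[u m](subrK (u n)) addrC; apply: rat_padic_norm_eq => //.
by rewrite (lt_le_trans _ eun) //; apply: uC => //; exact: leq_trans nm.
Qed.

Lemma padic_inv_ex (x : padic) : x != 0 -> exists y : padic, y * x = 1.
Proof.
move=> x0; set u := repr x.
have ux : cls u = x by rewrite /u reprK.
have u0 : u \notin padic_null.
  apply: contra x0 => u0; rewrite -ux; apply/eqP.
  have <- : cls (0 : padic_cauchy_seq) = 0 by rewrite rmorph0.
  by apply/padic_null_eq; rewrite subr0.
have [N [uN0 uN]] := nonnull_norm u0; set c := nq (u N) in uN0 uN.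
have un0 n : (N <= n)%N -> u n != 0.
  by move=> Nn; rewrite -(rat_padic_norm_eq0 p_pr) uN.
have c0 : 0 < c by rewrite lt_neqAle eq_sym uN0 rat_padic_norm_ge0.
have vC : (fun n => (u n)^-1) \in (padic_cauchy p_pr).
  apply/asboolP => e e0; have /asboolP uC := valP u.
  have [N' uN'] := uC (e * c * c) (mulr_gt0 (mulr_gt0 e0 c0) c0).
  exists (maxn N N') => m n; rewrite !geq_max => /andP[m1 m2] /andP[n1 n2].
  have um := un0 m m1; have un := un0 n n1.
  rewrite -(ltr_pM2r c0) -(ltr_pM2r c0) -[in X in X * _ < _](uN m m1) -[in X in _ * X < _](uN n n1).
  rewrite -!rat_padic_normM // (_ : _ * _ = u n - u m); first exact: uN'.
  by rewrite -[val u]/(u : nat -> rat); field; rewrite um un.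
exists (cls (PadicCauchySeq vC)); rewrite -ux -rmorphM -[1](rmorph1 (\pi_{ideal_quot padic_null_idealr})%qT).
apply/padic_null_eq/asboolP => e e0; exists N => n Nn.
rewrite -[(_ : padic_cauchy_seq) n]/((u n)^-1 * u n - 1) (mulVf (un0 n Nn)).
by rewrite subrr rat_padic_norm0.
Qed.

Definition padic_inv (x : padic) : padic :=
  if x == 0 then 0 else xget 0 [set y | y * x = 1].

Lemma padic_mulVf (x : padic) : x != 0 -> padic_inv x * x = 1.
Proof.
move=> x0; rewrite /padic_inv (negbTE x0).
by case: xgetP => // /= H; case: (padic_inv_ex x0) => y /H.
Qed.

Lemma padic_inv0 : padic_inv 0 = 0. Proof. by rewrite /padic_inv eqxx. Qed.

HB.instance Definition _ :=
  GRing.ComNzRing_isField.Build padic padic_mulVf padic_inv0.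

End PadicNumbers.

Section PadicNorm.
Variables (p : nat) (p_pr : prime p).
Local Notation Qp := (padic p_pr).
Local Notation nq := (rat_padic_norm p).
Local Notation cls u := (\pi_{ideal_quot padic_null_idealr p_pr}%qT u : Qp).
Implicit Types x y : Qp.

Definition padic_norm (x : Qp) : rat := limn (fun n => nq (repr x n) : rat^o).

Lemma padic_cls_eq0 (u : padic_cauchy_seq p_pr) :
  (cls u == 0) = (u \in @padic_null p p_pr).
Proof.
have <- : cls (0 : padic_cauchy_seq p_pr) = 0 by rewrite rmorph0.
by apply/eqP/idP => [/padic_null_eq|H]; [|apply/padic_null_eq]; rewrite subr0.
Qed.

Lemma padic_norm_near (u : padic_cauchy_seq p_pr) : cls u != 0 ->
  \forall n \near \oo, nq (u n) = padic_norm (cls u).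
Proof.
move=> u0; set v := repr (cls u).
have uv : cls u = cls v by rewrite /v reprK.
have v0 : v \notin @padic_null p p_pr by rewrite -padic_cls_eq0 -uv.
have [N [vN0 vN]] := nonnull_norm v0; set c := nq (v N) in vN0 vN.
have c0 : 0 < c by rewrite lt_neqAle eq_sym vN0 rat_padic_norm_ge0.
have -> : padic_norm (cls u) = c.
  apply: (@cvg_lim rat^o) => //; apply: cvg_near_cst; exists N => //.
have /asboolP /(_ c c0)[N' uvN] := (padic_null_eq u v).1 uv.
exists (maxn N N') => // n /=; rewrite geq_max => /andP[Nn N'n].
rewrite -(subrK (v n) (u n)) addrC (rat_padic_norm_eq p_pr) ?vN //.
exact: uvN.
Qed.

Lemma padic_norm0 : padic_norm 0 = 0.
Proof.
have : cls (repr (0 : Qp)) == 0 by rewrite reprK.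
rewrite padic_cls_eq0 => /asboolP u0; apply: (@cvg_lim rat^o) => //.
apply/cvgrPdist_lt => e e0; have [N uN] := u0 e e0.
by exists N => // n /= Nn; rewrite sub0r normrN ger0_norm ?rat_padic_norm_ge0 ?uN.
Qed.

Lemma padic_norm_neq0 x : x != 0 -> exists n : nat,
  forall m, (n <= m)%N -> nq (repr x m) = padic_norm x.
Proof.
move=> x0; have ux : cls (repr x) = x by rewrite reprK.
have := @padic_norm_near (repr x); rewrite ux => /(_ x0)[n _ H].
by exists n => m; exact: H.
Qed.

Lemma padic_norm_ge0 x : 0 <= padic_norm x.
Proof.
have [->|/padic_norm_neq0[n /(_ n (leqnn n)) <-]] := eqVneq x 0.
  by rewrite padic_norm0.
exact: rat_padic_norm_ge0.
Qed.

Lemma padic_norm_eq0 x : (padic_norm x == 0) = (x == 0).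
Proof.
have [->|x0] := eqVneq x 0; first by rewrite padic_norm0 eqxx.
have ux : cls (repr x) = x by rewrite reprK.
have : repr x \notin @padic_null p p_pr by rewrite -padic_cls_eq0 ux.
move/nonnull_norm => [N [uN0 uN]]; have [M uM] := padic_norm_neq0 x0.
by rewrite -(uM (maxn N M) (leq_maxr _ _)) uN ?leq_maxl // (negbTE uN0).
Qed.

Lemma padic_norm_exp x : x != 0 -> exists k : int, padic_norm x = p%:Q ^ (- k).
Proof.
move=> x0; have [n /(_ n (leqnn n)) nE] := padic_norm_neq0 x0.
exists (rat_padic_val p (repr x n)); rewrite -nE /rat_padic_norm ifN //.
by rewrite -(rat_padic_norm_eq0 p_pr) nE padic_norm_eq0.
Qed.

Lemma padic_normM x y : padic_norm (x * y) = padic_norm x * padic_norm y.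
Proof.
have [->|x0] := eqVneq x 0; first by rewrite mul0r padic_norm0 mul0r.
have [->|y0] := eqVneq y 0; first by rewrite mulr0 padic_norm0 mulr0.
have xyE : cls (repr x * repr y) = x * y by rewrite rmorphM /= !reprK.
have [] := @padic_norm_near (repr x * repr y); first by rewrite xyE mulf_neq0.
have [k kE] := padic_norm_neq0 x0; have [l lE] := padic_norm_neq0 y0.
move=> N _ H; pose m := maxn N (maxn k l).
rewrite -xyE -(H m) /= ?leq_maxl // -(kE m); last first.
  by rewrite /m maxnCA leq_maxl.
rewrite -(lE m); last by rewrite /m maxnA leq_maxr.
by rewrite -rat_padic_normM.
Qed.

Lemma padic_normD x y : padic_norm (x + y) <= Num.max (padic_norm x) (padic_norm y).
Proof.
have [->|x0] := eqVneq x 0; first by rewrite add0r le_max lexx orbT.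
have [->|y0] := eqVneq y 0; first by rewrite addr0 le_max lexx.
have [->|xy0] := eqVneq (x + y) 0.
  by rewrite padic_norm0 le_max padic_norm_ge0.
have xyE : cls (repr x + repr y) = x + y by rewrite rmorphD /= !reprK.
have [] := @padic_norm_near (repr x + repr y); first by rewrite xyE.
have [k kE] := padic_norm_neq0 x0; have [l lE] := padic_norm_neq0 y0.
move=> N _ H; pose m := maxn N (maxn k l).
rewrite -xyE -(H m) /= ?leq_maxl // -(kE m); last first.
  by rewrite /m maxnCA leq_maxl.
rewrite -(lE m); last by rewrite /m maxnA leq_maxr.
exact: rat_padic_normD.
Qed.

Lemma padic_normN x : padic_norm (- x) = padic_norm x.
Proof.
have [->|x0] := eqVneq x 0; first by rewrite oppr0.
apply/eqP; rewrite -(@eqrXn2 _ 2) ?padic_norm_ge0 // !expr2 -!padic_normM.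
by rewrite mulrNN.
Qed.

Lemma padic_dist0 x : padic_norm (x - x) = 0.
Proof. by rewrite subrr padic_norm0. Qed.

Lemma padic_dist0_eq x y : padic_norm (x - y) = 0 -> x = y.
Proof. by move/eqP; rewrite padic_norm_eq0 subr_eq0 => /eqP. Qed.

Lemma padic_distC x y : padic_norm (x - y) = padic_norm (y - x).
Proof. by rewrite -padic_normN opprB. Qed.

Lemma padic_dist_triangle y x z :
  padic_norm (x - z) <= padic_norm (x - y) + padic_norm (y - z).
Proof.
rewrite -(subrKA y) (le_trans (padic_normD _ _)) // ge_max lerDl lerDr.
by rewrite !padic_norm_ge0.
Qed.

HB.instance Definition _ := isMetric.Build rat Qp
  padic_dist0 padic_dist0_eq padic_distC padic_dist_triangle.

(* |x|_p = p ^ (- v_p(x)) for x != 0, see padic_norm_exp. *)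
Definition padic_val (x : Qp) : \bar int :=
  if x == 0 then +oo%E
  else (xget 0 [set k : int | padic_norm x = p%:Q ^ (- k)])%:E.

End PadicNorm.

Section PadicVectors.
Variables (p : nat) (p_pr : prime p) (n : nat).
Local Notation Qp := (padic p_pr).
Local Notation Qpn := 'rV[Qp]_n.
Implicit Types x y : Qpn.

Definition padic_vec_norm x : rat := \big[Num.max/0]_(i < n) padic_norm (x 0 i).

Definition padic_vec_val x : \bar int :=
  \big[Order.min/+oo%E]_(i < n) padic_val (x 0 i).

Definition padic_dot x y : Qp := \sum_(i < n) x 0 i * y 0 i.

Lemma padic_vec_norm_le x (e : rat) : 0 <= e ->
  (padic_vec_norm x <= e) = [forall i, padic_norm (x 0 i) <= e].
Proof.
move=> e0; apply/idP/forallP => [xe i|xe].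
  by rewrite (le_trans _ xe) // le_bigmax_cond.
by apply/bigmax_leP; split.
Qed.

End PadicVectors.

Section Fourier.
Variables (R : realType) (p : nat) (p_pr : prime p).
Local Notation Qp := (padic p_pr).

(* The fractional part {x}_p, characterised as the unique element of
   Z[1/p] `&` [0, 1[ that is congruent to x modulo Z_p. *)
Definition padic_frac (x : Qp) : rat :=
  xget 0 [set r : rat | [/\ 0 <= r < 1,
    exists m : nat, r * p%:Q ^+ m \is a Num.int &
    padic_norm (x - ratr r) <= 1]].

Definition padic_char (x : Qp) : R[i] :=
  let t := 2 * pi * ratr (padic_frac x) in (cos t +i* sin t)%C.

Variable n : nat.
Local Notation Qpn := 'rV[Qp]_n.

Definition padic_borel := g_sigma_algebraType (@open Qpn).

(* Invariance and mass 1 on Z_p^n already force mu to be finite on compact sets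
   (hence regular, Q_p^n being second countable), i.e. to be a Haar measure. *)
Definition normalized_haar (mu : set padic_borel -> \bar R) : Prop :=
  (forall (x : Qpn) (A : set padic_borel), measurable A ->
    mu [set x + y | y in (A : set Qpn)] = mu A) /\
  mu [set x : Qpn | padic_vec_norm x <= 1] = 1%E.

Definition schwartz_bruhat (f : Qpn -> R[i]) : Prop :=
  (forall x, \forall y \near x, f y = f x) /\
  compact (closure [set x | f x != 0]).

Variable mu : {measure set padic_borel -> \bar R}.

Definition complex_integrable (f : Qpn -> R[i]) : Prop :=
  mu.-integrable setT (fun x : padic_borel => (complex.Re (f x))%:E) /\
  mu.-integrable setT (fun x : padic_borel => (complex.Im (f x))%:E).

Definition complex_integral (f : Qpn -> R[i]) : R[i] :=
  ((\int[mu]_x complex.Re (f x)) +i* (\int[mu]_x complex.Im (f x)))%C.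

Definition padic_fourier (f : Qpn -> R[i]) (xi : Qpn) : R[i] :=
  complex_integral (fun x => f x * padic_char (padic_dot x xi)).

End Fourier.

Section Tree.
Variables (p : nat) (p_pr : prime p) (n : nat).
Local Notation Qp := (padic p_pr).
Local Notation Qpn := 'rV[Qp]_n.
Implicit Types (x y : Qpn) (k : int).

Definition padic_ball x k : set Qpn :=
  [set y | padic_vec_norm (y - x) <= p%:Q ^ (- k)].

Definition vertex_equiv (u v : Qpn * int) : bool :=
  (u.2 == v.2) && (padic_vec_norm (u.1 - v.1) <= p%:Q ^ (- u.2)).

Let p_exp_ge0 k : 0 <= p%:Q ^ k.
Proof. by rewrite exprz_ge0 // ler0z. Qed.

Lemma vertex_equiv_refl : reflexive vertex_equiv.
Proof.
move=> u; rewrite /vertex_equiv eqxx padic_vec_norm_le //.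
by apply/forallP => i; rewrite subrr mxE padic_norm0.
Qed.

Lemma vertex_equiv_sym : symmetric vertex_equiv.
Proof.
move=> [x k] [y l]; rewrite /vertex_equiv /= [l == k]eq_sym.
case: (eqVneq k l) => //= ->; rewrite (padic_vec_norm_le _ (p_exp_ge0 _)) (padic_vec_norm_le _ (p_exp_ge0 _)).
by apply: eq_forallb => i; rewrite !mxE padic_distC.
Qed.

Lemma vertex_equiv_trans : transitive vertex_equiv.
Proof.
move=> [y l] [x k] [z m] /andP[/= /eqP-> xy] /andP[/= /eqP <- yz].
rewrite /vertex_equiv eqxx /= (padic_vec_norm_le _ (p_exp_ge0 _)).
move: xy yz; rewrite (padic_vec_norm_le _ (p_exp_ge0 _)) (padic_vec_norm_le _ (p_exp_ge0 _)) => /forallP xy /forallP yz.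
apply/forallP => i; rewrite -(subrKA y) mxE (le_trans (padic_normD _ _)) //.
by rewrite ge_max xy yz.
Qed.

Canonical vertex_equiv_rel :=
  EquivRel vertex_equiv vertex_equiv_refl vertex_equiv_sym vertex_equiv_trans.

(* Pairs (x, k) with x in Q_p^n / p^k Z_p^n, as classes of pairs. *)
Definition vertex := {eq_quot vertex_equiv}%qT.
HB.instance Definition _ := Choice.on vertex.

Definition vtx x k : vertex := (\pi_{eq_quot vertex_equiv} (x, k))%qT.

Definition level (v : vertex) : int := (repr v).2.

Definition lower_shift (a : {ffun 'I_n -> 'I_p}) k : Qpn :=
  (p%:R ^ k) *: \row_i (a i : nat)%:R.

Definition neighbors (v : vertex) : set vertex :=
  [set u | exists x k, v = vtx x k /\
    (u = vtx x (k - 1) \/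
     exists a : {ffun 'I_n -> 'I_p}, u = vtx (x + lower_shift a k) (k + 1))].

(* The end compactification: vertices together with the ends Q_p^n and oo. *)
Inductive end_compactification :=
  | Vertex of vertex
  | FiniteEnd of Qpn
  | InfiniteEnd.

HB.instance Definition _ := gen_eqMixin end_compactification.
HB.instance Definition _ := gen_choiceMixin end_compactification.

(* The lower of the two components, ends included, into which the tree is cut
   by removing the edge between (x, k - 1) and (x, k). *)
Definition lower_half_tree x k : set end_compactification :=
  [set z | match z with
    | Vertex v => exists2 y, padic_ball x k y & exists2 l, k <= l & v = vtx y l
    | FiniteEnd y => padic_ball x k y
    | InfiniteEnd => False
    end].

(* The end topology: the half-trees cut out by edges form a subbase (they
   isolate every vertex, the tree being locally finite). *)
HB.instance Definition _ := isSubBaseTopological.Build end_compactification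
  [set A : set end_compactification | exists x k,
    A = lower_half_tree x k \/ A = ~` lower_half_tree x k] id.

End Tree.

Section Dirichlet.
Variables (R : realType) (p : nat) (p_pr : prime p) (n : nat) (s : R).
Local Notation Qpn := 'rV[padic p_pr]_n.
Local Notation vertex := (vertex p_pr n).
Implicit Types (f : Qpn -> R[i]) (phi : vertex -> R[i]).

(* The edge between (x, k - 1) and (x, k) has weight p ^ (k (s - n)). *)
Definition edge_weight (u v : vertex) : R :=
  p%:R `^ ((Order.max (level u) (level v))%:~R * (s - n%:R)).

Definition laplacian phi (v : vertex) : R[i] :=
  \sum_(u \in neighbors v) (edge_weight u v)%:C%C * (phi u - phi v).

Definition end_extension phi f (z : end_compactification p_pr n) : R[i]^o :=
  match z with
  | Vertex v => phi v
  | FiniteEnd x => f x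
  | InfiniteEnd => 0
  end.

Record dirichlet_solution f phi : Prop := {
  dirichlet_bounded : exists M : R, forall v, `|phi v| <= M%:C%C;
  dirichlet_continuous : continuous (end_extension phi f);
  dirichlet_harmonic : forall v, laplacian phi v = 0 }.

Definition layer phi (k : int) (x : Qpn) : R[i] := phi (vtx x k).

End Dirichlet.

(* Main.v *)
(* Let q = p^-s, and let E_k denote averaging over the p^n lower neighbors of the
   vertices of level k. Harmonicity says that the increments u_k = phi_k - phi_{k-1}
   satisfy E_k u_{k+1} = q u_k, so that G_k = phi_k + q / (1 - q) u_k is a martingale,
   E_k G_{k+1} = G_k, which converges to f at every end. As f is constant on the balls
   of some level L, G_k = f for k >= L: otherwise the defect would persist along a
   whole ray, whose end contradicts the convergence. Hence G_k is the average of f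
   over balls of level k, its Fourier transform is that of f restricted to
   |xi| <= p^k, and its L^1 norm is at most that of f.
   Moreover phi_k = (1 - q) G_k + q phi_{k-1}. Iterating this, boundedness of phi and
   Fatou's lemma bound the L^1 norm of phi_k by that of f; then the transforms of the
   layers form the unique solution, bounded in k, of the transformed recursion, and
   the right-hand side of the formula is such a solution. *)
Require Import Defs.
From HB Require Import structures.
From mathcomp Require Import all_boot all_order all_algebra.
From mathcomp Require Import all_classical all_reals all_analysis.
From mathcomp Require Import complex measurable_realfun.
From mathcomp Require Import ring lra zify.

Import Order.TTheory GRing.Theory Num.Theory numFieldNormedType.Exports.
Local Open Scope classical_set_scope.
Local Open Scope ring_scope.

Set Implicit Arguments.
Unset Strict Implicit.
Unset Printing Implicit Defensive.

(** * Rationals and digits in Q_p *)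

Section RationalsInQp.
Variables (p : nat) (p_pr : prime p).
Local Notation Qp := (padic p_pr).
Local Notation nq := (rat_padic_norm p).
Local Notation cls u := (\pi_{ideal_quot padic_null_idealr p_pr}%qT u : Qp).
Implicit Types (x y : Qp) (r : rat) (k : int).

Lemma padic_base_gt1 : 1 < p%:Q.
Proof. by rewrite (ltr_int _ 1); exact: prime_gt1. Qed.

Lemma padic_base_gt0 : 0 < p%:Q.
Proof. exact: lt_trans padic_base_gt1. Qed.

Lemma padic_base_exp_gt0 k : 0 < p%:Q ^ k.
Proof. exact/exprz_gt0/padic_base_gt0. Qed.

Lemma padic_base_exp_ge0 k : 0 <= p%:Q ^ k.
Proof. exact/ltW/padic_base_exp_gt0. Qed.

Lemma ler_padic_base_exp k l : (p%:Q ^ k <= p%:Q ^ l) = (k <= l).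
Proof. by rewrite ler_eXz2l // padic_base_gt1. Qed.

Lemma padic_base_expNS k : p%:Q ^ (- (k + 1)) = p%:Q ^ (- k) * p%:Q^-1.
Proof. by rewrite opprD expfzDr ?gt_eqF ?padic_base_gt0. Qed.

Lemma padic_base_exp_small k (e : rat) : 0 < e ->
  exists N : nat, p%:Q ^ (- (k + N%:Z)) < e.
Proof.
move=> e0; pose N := Num.bound (p%:Q ^ (- k) / e); exists N.
have pN_gt0 : 0 < p%:Q ^+ N by exact: padic_base_exp_gt0 N.
rewrite opprD expfzDr ?gt_eqF ?padic_base_gt0 // -exprnN.
rewrite ltr_pdivrMr // mulrC -ltr_pdivrMr //.
apply: (lt_trans (archi_boundP _)).
  by rewrite divr_ge0 ?padic_base_exp_ge0 // ltW.
by rewrite -pmulrn -natrX ltr_nat ltn_expl // prime_gt1.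
Qed.

Lemma rat_padic_norm_int (a : int) : a != 0 ->
  nq a%:Q = p%:Q ^ (- (logn p `|a|)%:Z).
Proof.
move=> a0.
by rewrite -[a%:Q]divr1 -[1]/(1%:Q) rat_padic_norm_frac// logn1 sub0r.
Qed.

Lemma rat_padic_norm_pexp k : nq (p%:Q ^ k) = p%:Q ^ (- k).
Proof.
have nat_exp m : nq (p%:Q ^+ m) = p%:Q ^- m.
  elim: m => [|m IHm]; first by rewrite !expr0 invr1 rat_padic_norm1.
  rewrite !exprS rat_padic_normM // IHm invfM; congr (_ * _).
  rewrite rat_padic_norm_int ?eqz_nat -?lt0n ?prime_gt0 //=.
  by rewrite logn_prime // eqxx exprN1.
case: k => m; rewrite -?exprnP ?NegzE ?opprK -?exprnN ?nat_exp //; rewrite -?exprnP.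
have b0 : p%:Q ^+ m.+1 != 0 by rewrite expf_neq0 // gt_eqF // padic_base_gt0.
apply: (mulIf (x := nq (p%:Q ^+ m.+1))); first by rewrite rat_padic_norm_eq0.
by rewrite -rat_padic_normM // mulVf // rat_padic_norm1 nat_exp mulfV.
Qed.

Lemma rat_padic_norm_int_pexp (a : int) (m : nat) :
  (nq a%:Q <= p%:Q ^ (- m%:Z)) = (p ^ m %| `|a|)%N.
Proof.
have [->|a0] := eqVneq a 0.
  by rewrite rat_padic_norm0 padic_base_exp_ge0 dvdn0.
rewrite rat_padic_norm_int // ler_padic_base_exp lerN2 lez_nat.
by rewrite pfactor_dvdn // absz_gt0.
Qed.

Lemma rat_padic_norm_int_le1 (a : int) : nq a%:Q <= 1.
Proof. by have := rat_padic_norm_int_pexp a 0; rewrite expn0 dvd1n. Qed.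

(* Z[1/p] `&` Z_p = Z *)
Lemma padic_integral_int r (m : nat) :
  r * p%:Q ^+ m \is a Num.int -> nq r <= 1 -> r \is a Num.int.
Proof.
move=> /intrP[a aE] r1.
have pm0 : p%:Q ^+ m != 0 by rewrite expf_neq0 // gt_eqF // padic_base_gt0.
have : nq a%:Q <= p%:Q ^ (- m%:Z).
  rewrite -aE rat_padic_normM // exprnP rat_padic_norm_pexp.
  by rewrite ler_piMl // padic_base_exp_ge0.
rewrite rat_padic_norm_int_pexp -[(p ^ m)%N]/(`|(p ^ m)%N%:Z|%N) -dvdzE.
case/dvdzP => b bE; apply/intrP; exists b; apply: (mulIf pm0).
by rewrite aE bE intrM; congr (_ * _); rewrite -pmulrn natrX.
Qed.

Lemma const_padic_cauchy r : (fun _ : nat => r) \in padic_cauchy p_pr.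
Proof.
by apply/asboolP => e e0; exists 0%N => m n _ _; rewrite subrr rat_padic_norm0.
Qed.

(** A concrete form of [ratr] (see [ratr_padic]): the norm of the class of a constant sequence can
    be read off its terms. *)
Definition padic_of_rat r : Qp := cls (PadicCauchySeq (const_padic_cauchy r)).

Lemma padic_of_rat_is_zmod_morphism : zmod_morphism padic_of_rat.
Proof. by move=> r t; rewrite /padic_of_rat -rmorphB; congr (cls _); exact/val_inj. Qed.

Lemma padic_of_rat_is_monoid_morphism : monoid_morphism padic_of_rat.
Proof.
split; first by rewrite -[1 in RHS](rmorph1 (\pi_{ideal_quot padic_null_idealr p_pr})%qT);
  congr (cls _); exact/val_inj.
by move=> r t; rewrite /padic_of_rat -rmorphM; congr (cls _); exact/val_inj.
Qed.

HB.instance Definition _ := GRing.isZmodMorphism.Build rat Qp padic_of_rat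
  padic_of_rat_is_zmod_morphism.
HB.instance Definition _ := GRing.isMonoidMorphism.Build rat Qp padic_of_rat
  padic_of_rat_is_monoid_morphism.

Lemma ratr_padic r : ratr r = padic_of_rat r.
Proof. by rewrite fmorph_eq_rat. Qed.

Lemma padic_of_ratD : {morph padic_of_rat : r t / r + t}.
Proof. exact: rmorphD. Qed.

Lemma padic_of_rat_nat (m : nat) : padic_of_rat m%:Q = m%:R.
Proof. by rewrite -pmulrn rmorph_nat. Qed.

Lemma padic_norm_cls_le (u : padic_cauchy_seq p_pr) (e : rat) (N : nat) :
  0 <= e -> (forall m, (N <= m)%N -> nq (u m) <= e) -> padic_norm (cls u) <= e.
Proof.
move=> e0 ue; have [->|u0] := eqVneq (cls u) 0; first by rewrite padic_norm0.
have [M _ uM] := padic_norm_near u0.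
by rewrite -(uM (maxn M N)) /= ?leq_maxl // ue // leq_maxr.
Qed.

Lemma padic_norm_rat r : padic_norm (padic_of_rat r) = nq r.
Proof.
have [->|r0] := eqVneq r 0; first by rewrite rmorph0 padic_norm0 rat_padic_norm0.
have r0' : padic_of_rat r != 0 by rewrite fmorph_eq0.
by have [M _ /(_ M (leqnn _)) <-] := padic_norm_near r0'.
Qed.

Lemma padic_norm_pexp k : padic_norm (p%:R ^ k : Qp) = p%:Q ^ (- k).
Proof.
by rewrite -rat_padic_norm_pexp -padic_norm_rat fmorphXz /= padic_of_rat_nat.
Qed.

Lemma padic_norm_nat_le1 (m : nat) : padic_norm (m%:R : Qp) <= 1.
Proof.
by rewrite -padic_of_rat_nat padic_norm_rat rat_padic_norm_int_le1.
Qed.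

Lemma padic_normD_le x y (e : rat) :
  padic_norm x <= e -> padic_norm y <= e -> padic_norm (x + y) <= e.
Proof. by move=> xe ye; rewrite (le_trans (padic_normD _ _)) // ge_max xe. Qed.

Lemma padic_dist_of_ratD x y r t : padic_norm (x - padic_of_rat r) <= 1 ->
  padic_norm (y - padic_of_rat t) <= 1 ->
  padic_norm (x + y - padic_of_rat (r + t)) <= 1.
Proof. by move=> xr yt; rewrite padic_of_ratD opprD addrACA padic_normD_le. Qed.

(** Any term of a Cauchy representative will do, past the index beyond which the terms differ by
    less than 1. *)
Lemma padic_dense_rat x : exists r, padic_norm (x - padic_of_rat r) <= 1.
Proof.
have /asboolP /(_ 1 ltr01) [N uN] := valP (repr x).
exists (repr x N); rewrite -[x in x - _]reprK /padic_of_rat -rmorphB.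
apply: (padic_norm_cls_le (N := N)) => // m Nm.
exact/ltW/uN.
Qed.

(** Write [denq r] as p^m b with b prime to p. Bezout, u p^m + v b = 1, splits r into [numq r] u /
    b, which is p-integral, plus [numq r] v / p^m, whose numerator is then reduced modulo p^m. *)
Lemma rat_frac_exists r : exists t : rat, [/\ 0 <= t < 1,
  exists m : nat, t * p%:Q ^+ m \is a Num.int & nq (r - t) <= 1].
Proof.
set m := logn p `|denq r|; set d := `|denq r|%N; set b := (d`_p^')%N.
have dE : denq r = (p ^ m * b)%N%:Z.
  rewrite -[LHS]gez0_abs ?denq_ge0 //; congr Posz.
  by rewrite -p_part partnC // absz_gt0 denq_neq0.
have b_gt0 : (0 < b)%N by exact: part_gt0.
have pm_gt0 : (0 < p ^ m)%N by rewrite expn_gt0 prime_gt0.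
have cop_b : coprime p b by rewrite prime_coprime // -p'natE // part_pnat.
have /coprimezP[[u v] /= uvE] : coprimez (p ^ m)%N b by rewrite coprimezE /= coprimeXl.
set P := (p ^ m)%N%:Z.
have P_gt0 : 0 < P by rewrite ltz_nat.
have P0 : P%:Q != 0 by rewrite intr_eq0 gt_eqF.
have b0 : b%:Q != 0 by rewrite intr_eq0 gt_eqF // ltz_nat.
set c := v * numq r.
exists ((c %% P)%Z%:Q / P%:Q); split.
- rewrite divr_ge0 ?ler0z ?modz_ge0 ?gt_eqF // ?ltW //=.
  by rewrite ltr_pdivrMr ?ltr0z // mul1r ltr_int ltz_pmod.
- exists m; rewrite (_ : p%:Q ^+ m = P%:Q) ?divfK ?intr_int //.
  by rewrite /P -!pmulrn natrX.
- have nb : nq b%:Q = 1.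
    by rewrite rat_padic_norm_int ?eqz_nat -?lt0n //= logn_coprime.
  rewrite (_ : _ - _ = (numq r * u + (c %/ P)%Z * b%:Z)%:Q / b%:Q).
    rewrite -[X in X <= _]mulr1 -[X in _ * X <= _]nb -rat_padic_normM // divfK //.
    exact: rat_padic_norm_int_le1.
  rewrite -[r in LHS]divq_num_den dE PoszM -/P.
  have cE : (c %% P)%Z%:Q = c%:Q - (c %/ P)%Z%:Q * P%:Q.
    by rewrite -intrM -intrB {2}(divz_eq c P) addrC addKr.
  have nE : (numq r)%:Q = (numq r)%:Q * (u%:Q * P%:Q + v%:Q * b%:Q).
    by rewrite -!intrM -intrD uvE mulr1.
  rewrite cE /c !intrD !intrM {1}nE; field.
  by rewrite P0 b0.
Qed.

Lemma padic_frac_exists x : exists t : rat, [/\ 0 <= t < 1,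
  exists m : nat, t * p%:Q ^+ m \is a Num.int & padic_norm (x - ratr t) <= 1].
Proof.
have [r xr] := padic_dense_rat x; have [t [t01 tm rt]] := rat_frac_exists r.
exists t; split => //; rewrite -(subrKA (padic_of_rat r)) padic_normD_le //.
by rewrite ratr_padic -rmorphB padic_norm_rat.
Qed.

Lemma padic_fracP x : [/\ 0 <= padic_frac x < 1,
  exists m : nat, padic_frac x * p%:Q ^+ m \is a Num.int &
  padic_norm (x - padic_of_rat (padic_frac x)) <= 1].
Proof. by have := xgetPex 0 (padic_frac_exists x); rewrite ratr_padic. Qed.

(** Both [t] and [padic_frac x] lie in Z[1/p] and are congruent to [x] modulo Z_p, so their
    difference lies in Z[1/p] and in Z_p. *)
Lemma padic_frac_eq_int x t (m : nat) : t * p%:Q ^+ m \is a Num.int ->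
  padic_norm (x - padic_of_rat t) <= 1 -> t - padic_frac x \is a Num.int.
Proof.
move=> tm xt; have [_ [l xl]] := padic_fracP x => xf.
apply: (@padic_integral_int _ (m + l)); last first.
  rewrite -padic_norm_rat rmorphB -(subrKA x) padic_normD_le //.
  by rewrite padic_distC.
rewrite mulrBl !exprD mulrA; apply: rpredB.
  by rewrite rpredM // rpredX // intr_int.
by rewrite mulrCA rpredM // rpredX // intr_int.
Qed.

Lemma padic_frac_eq0 x : (padic_frac x == 0) = (padic_norm x <= 1).
Proof.
have [/andP[f0 f1] _] := padic_fracP x => xf.
apply/eqP/idP => [f_eq0|x1]; first by move: xf; rewrite f_eq0 rmorph0 subr0.
have /intrP[a aE] : 0 - padic_frac x \is a Num.int.
  by apply: (@padic_frac_eq_int _ _ 0); rewrite ?mul0r ?rmorph0 ?subr0.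
move: aE; rewrite sub0r => /eqP; rewrite eqr_oppLR => /eqP fE.
move: f0 f1; rewrite fE -intrN ler0z -[1]/(1%:Q) ltr_int => f0 f1.
by have /eqP -> : - a == 0 by rewrite eq_le f0 -ltzD1 add0r f1.
Qed.

(** The digit is p {x / p}: this element of Z[1/p] is congruent to x modulo p, hence p-integral,
    hence an integer, and it lies in [0, p[. *)
Lemma padic_digit x : padic_norm x <= 1 ->
  exists d : 'I_p, padic_norm (x - (d : nat)%:R) <= p%:Q^-1.
Proof.
move=> x1; set pX : Qp := p%:R.
have npX : padic_norm pX = p%:Q^-1 by rewrite -[pX]expr1z padic_norm_pexp.
have pX0 : pX != 0.
  by rewrite -padic_norm_eq0 npX invr_eq0 gt_eqF // padic_base_gt0.
have [/andP[f0 f1] [m fm]] := padic_fracP (x / pX).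
set t := padic_frac _ => xt.
have xE : padic_norm (x - padic_of_rat (t * p%:Q)) <= p%:Q^-1.
  rewrite -npX -[X in _ <= X]mul1r -[x](divfK pX0) rmorphM /=.
  by rewrite padic_of_rat_nat -mulrBl padic_normM ler_wpM2r // npX invr_ge0 ltW // padic_base_gt0.
have /intrP[a aE] : t * p%:Q \is a Num.int.
  apply: (@padic_integral_int _ m).
    by rewrite mulrAC rpredM // intr_int.
  rewrite -padic_norm_rat -[padic_of_rat _](subKr x) padic_normD_le // padic_normN.
  by rewrite (le_trans xE) // invf_le1 ?padic_base_gt0 // ltW // padic_base_gt1.
have a0 : 0 <= a.
  by rewrite -(ler0z rat) -aE mulr_ge0 // ltW // padic_base_gt0.
have ap : (`|a| < p)%N.
  rewrite -ltz_nat gez0_abs // -(ltr_int rat) -aE.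
  by rewrite gtr_pMl // padic_base_gt0.
exists (Ordinal ap) => /=; move: xE; rewrite aE -[in a%:~R](gez0_abs a0).
by rewrite padic_of_rat_nat.
Qed.

Lemma padic_digit_inj (d d' : 'I_p) :
  padic_norm ((d : nat)%:R - (d' : nat)%:R : Qp) <= p%:Q^-1 -> d = d'.
Proof.
wlog le_d : d d' / (d' <= d)%N => [H|].
  by case: (leqP d' d) => [/H//|/ltnW/H{}H]; rewrite padic_distC => /H.
rewrite -natrB // -padic_of_rat_nat padic_norm_rat => h.
have := rat_padic_norm_int_pexp (d - d')%N 1; rewrite expn1 [X in X = _]h /=.
move=> /esym dv; have [/eqP|d0] := posnP (d - d').
  by rewrite subn_eq0 => d1; apply/val_inj/anti_leq; rewrite d1.
have := dvdn_leq d0 dv.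
by move=> /leq_trans/(_ (leq_subr _ _)); rewrite leqNgt ltn_ord.
Qed.

(** The partial sums are rational and their tails are bounded ultrametrically, so they form a Cauchy
    sequence of rationals whose class is the sum [y]. *)
Lemma padic_series_converges (k : int) (a : nat -> nat) :
  exists y : Qp, forall m,
    padic_norm (y - \sum_(j < m) p%:R ^ (k + j%:Z) * (a j)%:R) <= p%:Q ^ (- (k + m%:Z)).
Proof.
pose u m : rat := \sum_(j < m) p%:Q ^ (k + j%:Z) * (a j)%:R.
have uB m N : (m <= N)%N -> nq (u N - u m) <= p%:Q ^ (- (k + m%:Z)).
  move=> /subnKC <-; elim: (N - m)%N => [|l IHl].
    by rewrite addn0 subrr rat_padic_norm0 padic_base_exp_ge0.
  rewrite addnS /u big_ord_recr /= -/(u _) addrAC.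
  rewrite (le_trans (rat_padic_normD p_pr _ _)) // ge_max IHl /=.
  rewrite rat_padic_normM // rat_padic_norm_pexp.
  rewrite -[X in _ <= X]mulr1 ler_pM ?padic_base_exp_ge0 ?rat_padic_norm_ge0 //.
    by rewrite ler_padic_base_exp lerN2 lerD2l lez_nat leq_addr.
  by rewrite pmulrn rat_padic_norm_int_le1.
have uC : u \in padic_cauchy p_pr.
  apply/asboolP => e e0.
  have [N p_e] := padic_base_exp_small k e0.
  exists N => m l Nm Nl; rewrite -(subrKA (u N)).
  apply: rat_padic_normD_lt => //; last rewrite rat_padic_normB //;
    by apply: le_lt_trans p_e; exact: uB.
exists (cls (PadicCauchySeq uC)) => m.
rewrite (_ : \sum_(_ < _) _ = padic_of_rat (u m)).
  rewrite /padic_of_rat -rmorphB; apply: (padic_norm_cls_le (N := m)).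
    exact: padic_base_exp_ge0.
  exact: uB.
rewrite rmorph_sum; apply: eq_bigr => j _; rewrite rmorphM rmorph_nat fmorphXz /=.
by rewrite padic_of_rat_nat.
Qed.

End RationalsInQp.

(** * Balls and characters of Q_p^n *)

Section PadicBalls.
Variables (p : nat) (p_pr : prime p) (n : nat).
Local Notation Qp := (padic p_pr).
Local Notation Qpn := 'rV[Qp]_n.
Implicit Types (x y z : Qpn) (k l : int) (a : {ffun 'I_n -> 'I_p}).

Lemma padic_ballP x k y :
  padic_ball x k y <-> forall i, padic_norm (y 0 i - x 0 i) <= p%:Q ^ (- k).
Proof.
rewrite /padic_ball /= padic_vec_norm_le ?padic_base_exp_ge0 //.
by split=> [/forallP h i|h]; [have := h i; rewrite !mxE|apply/forallP => i; rewrite !mxE].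
Qed.

Lemma padic_ball_refl x k : padic_ball x k x.
Proof. by apply/padic_ballP => i; rewrite subrr padic_norm0 padic_base_exp_ge0. Qed.

Lemma padic_ball_sym x k y : padic_ball x k y -> padic_ball y k x.
Proof. by move/padic_ballP => h; apply/padic_ballP => i; rewrite padic_distC. Qed.

Lemma padic_ball_trans y x k z : padic_ball x k y -> padic_ball y k z -> padic_ball x k z.
Proof.
move=> /padic_ballP xy /padic_ballP yz; apply/padic_ballP => i.
by rewrite -(subrKA (y 0 i)) padic_normD_le.
Qed.

Lemma padic_ball_le x k l : l <= k -> padic_ball x k `<=` padic_ball x l.
Proof.
move=> lk y /padic_ballP h; apply/padic_ballP => i.
by rewrite (le_trans (h i)) // ler_padic_base_exp // lerN2.
Qed.

Lemma padic_ballD x k y z : padic_ball (x + z) k (y + z) <-> padic_ball x k y.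
Proof.
by split=> /padic_ballP h; apply/padic_ballP => i; have := h i;
  rewrite !mxE opprD addrACA subrr addr0.
Qed.

Lemma padic_ballDl x k z : padic_ball x k (x + z) <-> padic_ball 0 k z.
Proof. by rewrite addrC -{1}[x]add0r padic_ballD. Qed.

Lemma nbhs_padic_ball x k : nbhs x (padic_ball x k).
Proof.
apply/nbhs_ballP; exists (p%:Q ^ (- k)); first exact: padic_base_exp_gt0.
move=> y [_ xy]; apply/padic_ballP => i; rewrite padic_distC.
exact/ltW/(xy 0 i).
Qed.

Lemma nbhs_padicP x (A : set Qpn) :
  nbhs x A <-> exists k : nat, padic_ball x k `<=` A.
Proof.
split=> [/nbhs_ballP[e e0 xA]|[k kA]]; last by apply: filterS kA _; exact: nbhs_padic_ball.
have [k ke] := padic_base_exp_small p_pr 0 e0; exists k => y /padic_ballP xy.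
apply: xA; split=> // i j; rewrite ord1; apply: le_lt_trans ke.
by rewrite add0r; have := xy j; rewrite padic_distC.
Qed.

Lemma open_padic_ball x k : open (padic_ball x k).
Proof.
rewrite openE => y xy; apply: filterS (nbhs_padic_ball y k) => z yz.
exact: padic_ball_trans yz.
Qed.

Lemma lower_shift_ball a k : padic_ball 0 k (lower_shift p_pr a k).
Proof.
apply/padic_ballP => i; rewrite !mxE subr0 padic_normM padic_norm_pexp.
by rewrite ler_piMr ?padic_base_exp_ge0 ?padic_norm_nat_le1.
Qed.

(** The balls of the children cover the ball of [x]: in each coordinate, take the digit of (y - x) /
    p^k. *)
Lemma lower_shift_exists x k y : padic_ball x k y ->
  exists a, padic_ball (x + lower_shift p_pr a k) (k + 1) y.
Proof.
move=> /padic_ballP xy; set pk : Qp := p%:R ^ k.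
have npk : padic_norm pk = p%:Q ^ (- k) by exact: padic_norm_pexp.
have pk0 : pk != 0 by rewrite -padic_norm_eq0 npk gt_eqF // padic_base_exp_gt0.
have digit i : exists d : 'I_p,
    padic_norm ((y 0 i - x 0 i) / pk - (d : nat)%:R) <= p%:Q^-1.
  apply: padic_digit; rewrite -(ler_pM2r (padic_base_exp_gt0 p_pr (- k))).
  by rewrite -npk -padic_normM divfK // mul1r npk.
have [d dE] := choice digit; exists [ffun i => d i]; apply/padic_ballP => i.
rewrite !mxE ffunE padic_base_expNS // -npk.
rewrite (_ : y 0 i - _ = ((y 0 i - x 0 i) / pk - (d i : nat)%:R) * pk).
  by rewrite padic_normM mulrC ler_wpM2l ?padic_norm_ge0.
by rewrite mulrBl divfK // opprD addrA [pk * _]mulrC.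
Qed.

Lemma lower_shift_inj x k a b :
  padic_ball (x + lower_shift p_pr a k) (k + 1) (x + lower_shift p_pr b k) -> a = b.
Proof.
rewrite ![x + _]addrC padic_ballD => /padic_ballP ab.
apply/ffunP => i; apply: (@padic_digit_inj _ p_pr).
rewrite padic_distC -(ler_pM2l (padic_base_exp_gt0 p_pr (- k))).
have := ab i; rewrite !mxE -mulrBr padic_normM.
by rewrite padic_norm_pexp => /le_trans -> //; rewrite padic_base_expNS.
Qed.

Fixpoint digit_path x k (a : nat -> {ffun 'I_n -> 'I_p}) (m : nat) : Qpn :=
  if m is m'.+1 then digit_path x k a m' + lower_shift p_pr (a m') (k + m'%:Z) else x.

(** Every downward ray from (x, k) ends at a point of Q_p^n: the digits chosen along the ray form a
    convergent series in each coordinate. *)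
Lemma digit_path_converges x k (a : nat -> {ffun 'I_n -> 'I_p}) :
  exists y, forall m : nat, padic_ball y (k + m%:Z) (digit_path x k a m).
Proof.
have /choice[y yE] := fun i => padic_series_converges p_pr k (fun m => a m i : nat).
exists (\row_i (x 0 i + y i)) => m; apply/padic_ball_sym/padic_ballP => i; rewrite mxE.
rewrite (_ : digit_path x k a m 0 i =
    x 0 i + \sum_(j < m) p%:R ^ (k + j%:Z) * (a j i : nat)%:R).
  by rewrite opprD addrACA subrr add0r.
elim: m => [|m IHm] /=; first by rewrite big_ord0 addr0.
by rewrite big_ord_recr /= addrA -IHm !mxE.
Qed.

End PadicBalls.

(** * The additive character of Q_p *)

Section Character.
Variables (R : realType) (p : nat) (p_pr : prime p).
Local Notation Qp := (padic p_pr).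
Local Notation chi := (@padic_char R p p_pr).
Implicit Types (x y : Qp) (t : R).

Let e t : R[i] := (cos t +i* sin t)%C.

Let eD t u : e (t + u) = e t * e u.
Proof. by rewrite /e cosD sinD; apply/eqP; rewrite eq_complex /= eqxx /= addrC eqxx. Qed.

Let e2pi : e (2 * pi) = 1.
Proof. by rewrite /e mulr_natl cos2pi sin2pi. Qed.

(** The representative [t] is allowed up to 2 so that it can be a sum of two fractional parts: it
    then exceeds [padic_frac x] by 0 or 1, and [e] has period 2 pi. *)
Lemma padic_char_eq x (t : rat) (m : nat) : t * p%:Q ^+ m \is a Num.int ->
  padic_norm (x - padic_of_rat p_pr t) <= 1 -> 0 <= t < 2 ->
  chi x = e (2 * pi * ratr t).
Proof.
move=> tm xt /andP[t0 t2]; have /intrP[c cE] := padic_frac_eq_int tm xt.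
have [/andP[f0 f1] _ _] := padic_fracP x.
have c2 : c < 2 by rewrite -(ltr_int rat) -cE ltrBlDr (lt_le_trans t2) // lerDl.
have cN1 : -1 < c by rewrite -(ltr_int rat) -cE ltrBrDr (lt_le_trans _ t0) // addrC subr_lt0.
have c01 : c = 0 \/ c = 1 by lia.
rewrite -(subrK (padic_frac x) t) cE rmorphD /= mulrDr eD.
by case: c01 => ->; rewrite ?rmorph0 ?rmorph1 ?mulr0 ?mulr1 ?e2pi /padic_char /e
  ?cos0 ?sin0 mul1r.
Qed.

Let itv01D (a b : rat) : 0 <= a < 1 -> 0 <= b < 1 -> 0 <= a + b < 2.
Proof. by move=> *; apply/andP; split; lra. Qed.

Lemma padic_charD x y : chi (x + y) = chi x * chi y.
Proof.
have [x01 [m xm]] := padic_fracP x; have [y01 [l yl]] := padic_fracP y.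
move=> yf xf.
rewrite (@padic_char_eq (x + y) (padic_frac x + padic_frac y) (m + l)).
- rewrite [LHS](_ : _ = e (2 * pi * ratr (padic_frac x)) * e (2 * pi * ratr (padic_frac y))) //.
  by rewrite -eD -mulrDr rmorphD.
- rewrite mulrDl !exprD mulrA [X in _ + X]mulrCA rpredD //.
    by rewrite rpredM // rpredX // intr_int.
  by rewrite rpredM // rpredX // intr_int.
- exact: padic_dist_of_ratD.
- exact: itv01D.
Qed.

Lemma padic_char_eq1 x : (chi x == 1) = (padic_norm x <= 1).
Proof.
rewrite -padic_frac_eq0; apply/eqP/eqP => [|f0]; last first.
  by rewrite /padic_char f0 rmorph0 mulr0 cos0 sin0.
case=> cos1 _; apply/eqP; have [/andP[f0 f1] _ _] := padic_fracP x.
apply: contraT => fn0; have {fn0}f0 : 0 < padic_frac x by rewrite lt_neqAle eq_sym fn0.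
set u : R := ratr (padic_frac x) in cos1.
(* The equation cos (2 pi u) = 1 forces sin (pi u) = 0, which is impossible for pi u strictly
   between 0 and pi. *)
have u01 : 0 < pi * u < pi.
  by rewrite mulr_gt0 ?pi_gt0 ?ltr0q //= gtr_pMr ?pi_gt0 // -[1](rmorph1 ratr) ltr_rat.
have := sin_gt0_pi u01; move: cos1; rewrite -mulrA mulr_natl cos_mulr2n cos2sin2.
rewrite mulr2n => sin1; have : sin (pi * u) ^+ 2 = 0 by lra.
by move/eqP; rewrite expf_eq0 /= => /eqP ->; rewrite ltxx.
Qed.

Lemma padic_char_Re_le1 x : `|complex.Re (chi x)| <= 1.
Proof. exact: cos_max. Qed.

Lemma padic_char_Im_le1 x : `|complex.Im (chi x)| <= 1.
Proof. exact: sin_max. Qed.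

End Character.

(** * The pairing, norm and valuation on Q_p^n *)

Section Dot.
Variables (p : nat) (p_pr : prime p) (n : nat).
Local Notation Qp := (padic p_pr).
Local Notation Qpn := 'rV[Qp]_n.
Implicit Types (x y xi : Qpn) (k : int).

Lemma padic_dotDl x y xi : padic_dot (x + y) xi = padic_dot x xi + padic_dot y xi.
Proof. by rewrite -big_split; apply: eq_bigr => i _; rewrite mxE mulrDl. Qed.

Lemma padic_dot_le1 x xi k : padic_ball 0 k x ->
  padic_vec_norm xi <= p%:Q ^ k -> padic_norm (padic_dot x xi) <= 1.
Proof.
move=> /padic_ballP x0; rewrite padic_vec_norm_le ?padic_base_exp_ge0 // => /forallP xik.
rewrite /padic_dot; elim/big_ind: _ => [|? ? h1 h2|i _]; first by rewrite padic_norm0.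
  by rewrite padic_normD_le.
have := x0 i; rewrite mxE subr0 => xi0.
rewrite padic_normM (le_trans (ler_pM _ _ xi0 (xik i))) ?padic_norm_ge0 //.
by rewrite -expfzDr ?gt_eqF ?padic_base_gt0 // addNr.
Qed.

(* The witness is a coordinate vector y with y . xi = 1 / p. *)
Lemma padic_dot_gt1_exists xi k : p%:Q ^ k < padic_vec_norm xi ->
  exists2 y, padic_ball 0 k y & 1 < padic_norm (padic_dot y xi).
Proof.
rewrite ltNge padic_vec_norm_le ?padic_base_exp_ge0 //.
rewrite negb_forall; case/existsP => i; rewrite -ltNge => xi_gt.
have np : padic_norm (p%:R ^ k : Qp) = p%:Q ^ (- k) by exact: padic_norm_pexp.
(* This is p^k times the basis vector of a coordinate [i] of norm above p^k: its pairing with [xi]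
   is p^k times that coordinate, of norm above 1 but in general not equal to 1 / p. *)
exists (\row_j if j == i then p%:R ^ k else 0).
  apply/padic_ballP => j; rewrite !mxE subr0; case: eqP => _; rewrite ?np //.
  by rewrite padic_norm0 padic_base_exp_ge0.
rewrite /padic_dot (bigD1 i) //= big1 => [|j ji]; last by rewrite mxE (negbTE ji) mul0r.
rewrite mxE eqxx addr0 padic_normM np; move: xi_gt.
rewrite -(ltr_pM2l (padic_base_exp_gt0 p_pr (- k)) (p%:Q ^ k)).
by rewrite -expfzDr ?gt_eqF ?padic_base_gt0 // addNr.
Qed.

Lemma padic_val_exp (x : Qp) : x != 0 -> exists2 k : int, padic_val x = k%:E &
  padic_norm x = p%:Q ^ (- k).
Proof.
move=> x0; rewrite /padic_val (negbTE x0); eexists; first by [].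
exact: (@xgetPex _ 0 [set k : int | padic_norm x = p%:Q ^ (- k)] (padic_norm_exp x0)).
Qed.

(** Turns the case distinction of the theorem into one on norms. A zero coordinate has valuation
    [+oo] and imposes nothing on either side; in particular [xi = 0] always falls in the first
    case. *)
Lemma padic_vec_val_le xi k :
  (- padic_vec_val xi <= k%:E)%E = (padic_vec_norm xi <= p%:Q ^ k).
Proof.
rewrite padic_vec_norm_le ?padic_base_exp_ge0 // leeNl -EFinN.
rewrite /padic_vec_val; apply/idP/forallP => [h i|h].
  have {}h : ((- k)%R%:E <= padic_val (xi 0%R i))%E.
    by apply: le_trans h _; exact: bigmin_le_cond.
  have [->|x0] := eqVneq (xi 0 i) 0; first by rewrite padic_norm0 padic_base_exp_ge0.
  have [l lE ->] := padic_val_exp x0; move: h; rewrite lE lee_fin => h.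
  by rewrite ler_padic_base_exp // lerNl.
apply/bigmin_geP; split=> [|i _]; first exact: leey.
have := h i; have [->|x0] := eqVneq (xi 0 i) 0.
  by move=> _; rewrite /padic_val eqxx leey.
have [l -> ->] := padic_val_exp x0.
by rewrite ler_padic_base_exp // lee_fin lerNl.
Qed.

Lemma padic_vec_norm_exp xi : padic_vec_norm xi != 0 ->
  exists k : int, padic_vec_norm xi = p%:Q ^ k.
Proof.
rewrite /padic_vec_norm; elim/big_ind: _ => [|u v hu hv|i _]; first by rewrite eqxx.
  by case: (leP u v).
by rewrite padic_norm_eq0 => /padic_norm_exp[k ->]; exists (- k).
Qed.

Lemma padic_vec_norm_eq_exp xi k : padic_vec_norm xi <= p%:Q ^ k ->
  ~~ (padic_vec_norm xi <= p%:Q ^ (k - 1)) -> padic_vec_norm xi = p%:Q ^ k.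
Proof.
move=> xik; rewrite -ltNge => xik1.
have /padic_vec_norm_exp[l lE] : padic_vec_norm xi != 0.
  by rewrite gt_eqF // (lt_trans _ xik1) // padic_base_exp_gt0.
move: xik xik1; rewrite lE ltNge !ler_padic_base_exp // => lk kl.
by congr (_ ^ _); lia.
Qed.

End Dot.

(** * Integrals of locally constant functions *)

Section L1Norm.
Variable R : realType.
Implicit Types (z w : R[i]) (c : R).

(* An R-valued substitute for the modulus, whose values are in R[i]. *)
Definition l1norm z : R := `|complex.Re z| + `|complex.Im z|.

Lemma l1norm_ge0 z : 0 <= l1norm z.
Proof. by rewrite addr_ge0. Qed.

Lemma l1norm0 : l1norm 0 = 0.
Proof. by rewrite /l1norm /= normr0 addr0. Qed.

Lemma l1norm_eq0 z : l1norm z = 0 -> z = 0.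
Proof.
case: z => a b /eqP; rewrite paddr_eq0 //= !normr_eq0 => /andP[/eqP-> /eqP->].
by [].
Qed.

Lemma l1normD z w : l1norm (z + w) <= l1norm z + l1norm w.
Proof. by case: z w => a b [c d]; rewrite /l1norm /= addrACA lerD // ler_normD. Qed.

Lemma l1normM z w : l1norm (z * w) <= l1norm z * l1norm w.
Proof.
case: z w => a b [c d]; rewrite /l1norm /= mulrDl !mulrDr -!normrM.
have := ler_normB (a * c) (b * d); have := ler_normD (a * d) (b * c).
by lra.
Qed.

Lemma l1normN z : l1norm (- z) = l1norm z.
Proof. by case: z => a b; rewrite /l1norm /= !normrN. Qed.

Lemma l1normZ c z : l1norm (c%:C%C * z) = `|c| * l1norm z.
Proof. by case: z => a b; rewrite /l1norm /= !mul0r subr0 addr0 !normrM mulrDr. Qed.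

Lemma l1norm_sum (I : finType) (F : I -> R[i]) :
  l1norm (\sum_i F i) <= \sum_i l1norm (F i).
Proof.
elim/big_ind2: _ => [|? ? ? ? h1 h2|//]; first by rewrite l1norm0.
by rewrite (le_trans (l1normD _ _)) // lerD.
Qed.

End L1Norm.

Section Integration.
Variables (R : realType) (p : nat) (p_pr : prime p) (n : nat).
Local Notation Qpn := 'rV[padic p_pr]_n.
Local Notation T := (padic_borel p_pr n).
Variable mu : {measure set T -> \bar R}.
Implicit Types (g h : Qpn -> R[i]) (k l : int).

Definition loc_const (X : Type) k (g : Qpn -> X) :=
  forall x y, padic_ball x k y -> g y = g x.

Lemma loc_const_le (X : Type) k l (g : Qpn -> X) : k <= l -> loc_const k g -> loc_const l g.
Proof. by move=> kl gk x y /(padic_ball_le kl); exact: gk. Qed.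

Lemma loc_const_open (X : Type) k (g : Qpn -> X) (A : set X) : loc_const k g -> open (g @^-1` A).
Proof.
move=> gk; rewrite openE => x gx; apply: filterS (nbhs_padic_ball x k) => y xy.
by rewrite /preimage /= (gk _ _ xy).
Qed.

Lemma open_measurable_padic (A : set Qpn) : open A -> measurable (A : set T).
Proof. exact: sub_sigma_algebra. Qed.

Lemma loc_const_measurable d (X : measurableType d) k (g : Qpn -> X) :
  loc_const k g -> measurable_fun setT (g : T -> X).
Proof.
move=> gk _ Y mY; rewrite setTI; apply: open_measurable_padic.
exact: loc_const_open gk.
Qed.

Lemma loc_const_comp (X Y : Type) (F : X -> Y) k (g : Qpn -> X) :
  loc_const k g -> loc_const k (F \o g).
Proof. by move=> gk x y /gk /= ->. Qed.

Lemma loc_const_comp2 (X Y Z : Type) (F : X -> Y -> Z) k (g : Qpn -> X) l (h : Qpn -> Y) :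
  loc_const k g -> loc_const l h ->
  loc_const (Num.max k l) (fun x => F (g x) (h x)).
Proof.
move=> gk hl x y xy.
by rewrite (gk x y) ?(hl x y) //; apply: padic_ball_le xy; rewrite le_max lexx ?orbT.
Qed.

Lemma loc_const_translate (X : Type) k (g : Qpn -> X) y :
  loc_const k g -> loc_const k (fun x => g (x + y)).
Proof. by move=> gk x z xz; apply: gk; rewrite padic_ballD. Qed.

Definition L1norm g : \bar R := (\int[mu]_(x in [set: T]) (l1norm (g x))%:E)%E.

(** Local constancy supplies measurability, so that integrability reduces to the finiteness of a
    single nonnegative integral. *)
Definition lc_integrable g := (exists k, loc_const k g) /\ (L1norm g < +oo)%E.

Let l1_measurable k g : loc_const k g -> 
  measurable_fun setT ((fun x => (l1norm (g x))%:E) : T -> \bar R).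
Proof.
move=> gk; apply: (@loc_const_measurable _ _ k).
exact: (loc_const_comp (fun z => (l1norm z)%:E)).
Qed.

Lemma lc_integrable_complex g : lc_integrable g -> complex_integrable mu g.
Proof.
move=> [[k gk] goo].
have gint : mu.-integrable setT (fun x : T => (l1norm (g x))%:E).
  apply/integrableP; split; first exact: l1_measurable gk.
  apply: le_lt_trans goo; rewrite le_eqVlt; apply/orP; left; apply/eqP.
  by apply: eq_integral => x _; rewrite /= ger0_norm ?l1norm_ge0.
split; (apply: le_integrable gint => //; first
  by apply: (@loc_const_measurable _ _ k); exact: (loc_const_comp (fun z => (_ z)%:E))).
  by move=> x _; rewrite /= lee_fin [X in _ <= X]ger0_norm ?l1norm_ge0 // lerDl.
by move=> x _; rewrite /= lee_fin [X in _ <= X]ger0_norm ?l1norm_ge0 // lerDr.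
Qed.

Lemma L1norm_le_lincomb (k l m : int) (c d : R) g h u : 0 <= c -> 0 <= d ->
  loc_const k g -> loc_const l h -> loc_const m u ->
  (forall x, l1norm (u x) <= c * l1norm (g x) + d * l1norm (h x)) ->
  (L1norm u <= c%:E * L1norm g + d%:E * L1norm h)%E.
Proof.
move=> c0 d0 gk hl um ule; rewrite /L1norm.
rewrite -!ge0_integralZl_EFin //; try by [move=> x _; rewrite lee_fin l1norm_ge0 |
  exact: l1_measurable hl | exact: l1_measurable gk].
rewrite -ge0_integralD //; try by [move=> x _; rewrite -EFinM lee_fin mulr_ge0 ?l1norm_ge0
 | apply: measurable_funeM; exact: l1_measurable hl
 | apply: measurable_funeM; exact: l1_measurable gk].
apply: ge0_le_integral => //.
- by move=> x _; rewrite lee_fin l1norm_ge0.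
- exact: l1_measurable um.
- apply: emeasurable_funD; apply: measurable_funeM; first exact: l1_measurable gk.
  exact: l1_measurable hl.
- by move=> x _; rewrite -!EFinM -EFinD lee_fin.
Qed.

Lemma L1norm_ge0 g : (0 <= L1norm g)%E.
Proof. by apply: integral_ge0 => x _; rewrite lee_fin l1norm_ge0. Qed.

Lemma L1norm_le (k l : int) (c : R) g u : 0 <= c -> loc_const k g -> loc_const l u ->
  (forall x, l1norm (u x) <= c * l1norm (g x)) -> (L1norm u <= c%:E * L1norm g)%E.
Proof.
move=> c0 gk ul ule.
have := @L1norm_le_lincomb k k l c 0 g g u c0 (lexx _) gk gk ul.
by rewrite mul0e adde0; apply=> x; rewrite mul0r addr0.
Qed.

Lemma lc_integrableD g h : lc_integrable g -> lc_integrable h ->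
  lc_integrable (fun x => g x + h x).
Proof.
move=> [[k gk] goo] [[l hl] hoo].
have gh : loc_const (Num.max k l) (fun x => g x + h x).
  exact: (loc_const_comp2 (fun z w => z + w)).
split; first by exists (Num.max k l).
apply: le_lt_trans (_ : 1%:E * L1norm g + 1%:E * L1norm h < +oo)%E.
  by apply: L1norm_le_lincomb gk hl gh _ => // x; rewrite !mul1r l1normD.
by rewrite !mul1e lte_add_pinfty.
Qed.

Lemma lc_integrableM (k : int) (M : R) g (u : Qpn -> R[i]) : lc_integrable g ->
  loc_const k u -> (forall x, l1norm (u x) <= M) -> lc_integrable (fun x => g x * u x).
Proof.
move=> [[l gl] goo] uk uM.
have M0 : 0 <= M by exact: le_trans (l1norm_ge0 _) (uM 0).
have gu : loc_const (Num.max l k) (fun x => g x * u x).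
  exact: (loc_const_comp2 (fun z w => z * w)).
split; first by exists (Num.max l k).
apply: le_lt_trans (_ : M%:E * L1norm g < +oo)%E.
  apply: L1norm_le gl gu _ => // x; rewrite (le_trans (l1normM _ _)) // mulrC.
  by rewrite ler_wpM2r ?l1norm_ge0.
by rewrite lte_mul_pinfty // lee_fin.
Qed.

Lemma lc_integrableZ (c : R[i]) g : lc_integrable g -> lc_integrable (fun x => c * g x).
Proof.
move=> gi; rewrite (_ : (fun x => c * g x) = (fun x => g x * c)).
  exact: (@lc_integrableM 0 (l1norm c) g (fun=> c)).
by apply/funext => x; rewrite mulrC.
Qed.

Lemma lc_integrable_sum (I : finType) (F : I -> Qpn -> R[i]) :
  lc_integrable (fun=> 0) -> 
  (forall i, lc_integrable (F i)) -> lc_integrable (fun x => \sum_i F i x).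
Proof.
move=> i0 Fi; rewrite (_ : (fun x => _) = \sum_i F i); last first.
  by apply/funext => x; rewrite fct_sumE.
by elim/big_ind: _ => // g h; exact: lc_integrableD.
Qed.

Lemma complex_integralD g h : complex_integrable mu g -> complex_integrable mu h ->
  complex_integral mu (fun x => g x + h x) =
    complex_integral mu g + complex_integral mu h.
Proof.
move=> [g1 g2] [h1 h2]; rewrite /complex_integral.
under eq_Rintegral do rewrite raddfD.
under [X in (_ +i* X)%C]eq_Rintegral do rewrite raddfD.
by rewrite !RintegralD.
Qed.

Lemma complex_integralZ c g : complex_integrable mu g ->
  complex_integral mu (fun x => c * g x) = c * complex_integral mu g.
Proof.
move=> [g1 g2]; rewrite /complex_integral; case: c => a b.
have lincomb (c d : R) (u v : T -> R) :
    mu.-integrable setT (EFin \o u) -> mu.-integrable setT (EFin \o v) ->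
    (\int[mu]_x (c * u x + d * v x) =
      c * (\int[mu]_x u x) + d * (\int[mu]_x v x))%R.
  move=> ui vi; rewrite RintegralD ?RintegralZl //.
    exact: (integrableZl measurableT c ui).
  exact: (integrableZl measurableT d vi).
have mulE x : (a +i* b)%C * g x =
    ((a * complex.Re (g x) + - b * complex.Im (g x)) +i*
     (a * complex.Im (g x) + b * complex.Re (g x)))%C.
  by case: (g x) => u v /=; rewrite mulNr.
under eq_Rintegral do rewrite mulE /=.
under [X in (_ +i* X)%C]eq_Rintegral do rewrite mulE /=.
by rewrite !lincomb //= mulNr.
Qed.

Lemma l1norm_complex_integral g : complex_integrable mu g ->
  ((l1norm (complex_integral mu g))%:E <= L1norm g)%E.
Proof.
move=> [g1 g2]; rewrite /L1norm /l1norm /=.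
have m1 := measurable_int _ g1; have m2 := measurable_int _ g2.
under eq_integral do rewrite EFinD.
rewrite ge0_integralD //; last 2 first.
- apply/measurable_EFinP; apply: measurableT_comp => //; exact/measurable_EFinP.
- apply/measurable_EFinP; apply: measurableT_comp => //; exact/measurable_EFinP.
have le_int (u : T -> R) : mu.-integrable setT (EFin \o u) ->
    (`|\int[mu]_x u x|%:E <= \int[mu]_x `|u x|%:E)%E.
  move=> ui; rewrite -[leRHS]fineK ?lee_fin; first exact: le_normr_Rintegral.
  exact: integrable_fin_num (integrable_abse ui).
by rewrite EFinD leeD // le_int.
Qed.

Lemma L1norm_fatou (F : nat -> Qpn -> R[i]) g (C : \bar R) (k : nat -> int) :
  (forall m, loc_const (k m) (F m)) ->
  (forall m, L1norm (F m) <= C)%E ->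
  (forall x, (l1norm (F m x - g x) : R) @[m --> \oo] --> (0:R)) ->
  (L1norm g <= C)%E.
Proof.
move=> Fk FC Fg.
(* By the triangle inequality, used both ways, the values of [l1norm] converge too; the integrand
   for [g] is thus a lower limit and Fatou's lemma applies. *)
have lim_l1 x : limn_einf (fun m => (l1norm (F m x))%:E) = (l1norm (g x))%:E.
  apply: (cvg_limn_einf_sup _).1; apply: cvg_EFin; first exact: nearW.
  apply/cvgrPdist_le => e e0; have /cvgrPdist_le /(_ e e0) := Fg x.
  apply: filterS => m; rewrite sub0r normrN ger0_norm ?l1norm_ge0 //=.
  have := l1normD (F m x - g x) (g x); rewrite subrK.
  have := l1normD (g x - F m x) (F m x); rewrite subrK -[l1norm (g x - _)]l1normN opprB.
  by rewrite ler_norml => *; apply/andP; split; lra.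
rewrite /L1norm; under eq_integral do rewrite -lim_l1.
apply: (@le_trans _ _ (limn_einf (fun m => L1norm (F m)))).
  apply: fatou => //; first by move=> m; exact: l1_measurable (Fk m).
  by move=> m x _; rewrite lee_fin l1norm_ge0.
rewrite limn_einf_lim; apply: lime_le; first exact: is_cvg_einfs.
by apply: nearW => m; apply: le_trans (FC m); apply: ereal_inf_lbound; exists m => /=.
Qed.

(** * Translation invariance of the integrals *)

Section Translation.
Hypothesis mu_haar : normalized_haar mu.

Let translate (y : Qpn) : T -> T := fun x => (x : Qpn) + y.

Let translate_measurable y : measurable_fun setT (translate y).
Proof.
apply: (@measurability _ _ T T _ _ (@open Qpn)) => //.
move=> _ [A oA <-]; rewrite setTI; apply: open_measurable_padic.
move: oA; rewrite !openE => oA x xA; have [k kA] := (nbhs_padicP _ _).1 (oA _ xA).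
apply/nbhs_padicP; exists k => z xz; apply: kA.
by rewrite /translate padic_ballD.
Qed.

Let pushforward_translate y (A : set T) : measurable A ->
  pushforward mu (translate y) A = mu A.
Proof.
move=> mA; rewrite /pushforward -(mu_haar.1 (- y) _ mA); congr (mu _).
apply/seteqP; split => [x xA|_ [x xA <-]].
  by exists (x + y) => //; rewrite addrCA addNr addr0.
by rewrite /preimage /translate /= addrAC addNr add0r.
Qed.

(** Change of variables: the image of [mu] under the translation agrees with [mu] on measurable
    sets. Real integrands reduce to this case through their positive and negative parts. *)
Let ge0_integral_translate y (u : T -> \bar R) : measurable_fun setT u ->
  (forall x, 0 <= u x)%E -> (\int[mu]_x u (translate y x) = \int[mu]_x u x)%E.
Proof.
move=> mu_ u0.
have := ge0_integral_pushforward (translate_measurable y) mu measurableT mu_.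
rewrite preimage_setT => <-; last by move=> x _; exact: u0.
apply: eq_measure_integral => A mA _; exact: pushforward_translate.
Qed.

Lemma L1norm_translate (k : int) g y : loc_const k g ->
  L1norm (fun x => g (x + y)) = L1norm g.
Proof.
move=> gk; rewrite /L1norm -[RHS](ge0_integral_translate y) //.
  exact: l1_measurable gk.
by move=> x; rewrite lee_fin l1norm_ge0.
Qed.

Lemma lc_integrable_translate g y : lc_integrable g -> lc_integrable (fun x => g (x + y)).
Proof.
move=> [[k gk] goo]; split; last by rewrite (L1norm_translate _ gk).
by exists k; exact: loc_const_translate.
Qed.

Let Rintegral_translate y (k : int) (u : Qpn -> R) : loc_const k u ->
  (\int[mu]_x u (translate y x) = \int[mu]_x u x)%R.
Proof.
move=> uk; rewrite /Rintegral; congr fine.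
have mEu : measurable_fun setT ((EFin \o u) : T -> \bar R).
  apply: (@loc_const_measurable _ _ k); exact: loc_const_comp.
rewrite [LHS]integralE [RHS]integralE; congr (_ - _)%E.
  rewrite -[RHS](ge0_integral_translate y (measurable_funepos mEu) (funepos_ge0 _)).
  by apply: eq_integral => x _; rewrite -[RHS](congr1 (@^~ x) (funepos_comp (EFin \o u) (translate y))).
rewrite -[RHS](ge0_integral_translate y (measurable_funeneg mEu) (funeneg_ge0 _)).
by apply: eq_integral => x _; rewrite -[RHS](congr1 (@^~ x) (funeneg_comp (EFin \o u) (translate y))).
Qed.

Lemma complex_integral_translate (k : int) g y : loc_const k g ->
  complex_integral mu (fun x => g (x + y)) = complex_integral mu g.
Proof.
move=> gk; rewrite /complex_integral.
have gRe : loc_const k (fun x => complex.Re (g x)) by exact: (loc_const_comp (@complex.Re R)).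
have gIm : loc_const k (fun x => complex.Im (g x)) by exact: (loc_const_comp (@complex.Im R)).
by rewrite -(Rintegral_translate y gRe) -(Rintegral_translate y gIm).
Qed.

End Translation.

End Integration.

(** * Fourier transforms of locally constant functions *)

Section FourierOfLocallyConstant.
Variables (R : realType) (p : nat) (p_pr : prime p) (n : nat).
Local Notation Qpn := 'rV[padic p_pr]_n.
Local Notation T := (padic_borel p_pr n).
Local Notation digits := {ffun 'I_n -> 'I_p}.
Variable mu : {measure set T -> \bar R}.
Hypothesis mu_haar : normalized_haar mu.
Implicit Types (g h : Qpn -> R[i]) (k l : int) (x y xi : Qpn).

Local Notation fourier := (padic_fourier mu).

Local Notation chi xi x := (padic_char R (padic_dot x xi)).

Lemma padic_char_dotD x y xi : chi xi (x + y) = chi xi x * chi xi y.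
Proof. by rewrite padic_dotDl padic_charD. Qed.

Lemma padic_char_dot_eq1 y xi k : padic_ball 0 k y -> padic_vec_norm xi <= p%:Q ^ k ->
  chi xi y = 1.
Proof. by move=> yk xik; apply/eqP; rewrite padic_char_eq1 (padic_dot_le1 yk). Qed.

Lemma padic_char_dot_loc_const xi : exists k, loc_const k (fun x => chi xi x).
Proof.
have [k xik] : exists k : int, padic_vec_norm xi <= p%:Q ^ k.
  have [->|/padic_vec_norm_exp[k ->]] := eqVneq (padic_vec_norm xi) 0; last by exists k.
  by exists 0; exact: padic_base_exp_ge0.
exists k => x y; rewrite -[y](subrK x) [_ + x]addrC padic_ballDl => xy.
by rewrite padic_char_dotD (padic_char_dot_eq1 xy xik) mulr1.
Qed.

Lemma l1norm_padic_char x xi : l1norm (chi xi x) <= 2.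
Proof.
have := padic_char_Re_le1 R (padic_dot x xi); have := padic_char_Im_le1 R (padic_dot x xi).
by rewrite /l1norm; lra.
Qed.

Lemma lc_integrable_char g xi : lc_integrable mu g ->
  lc_integrable mu (fun x => g x * padic_char R (padic_dot x xi)).
Proof.
move=> gi; have [k chik] := padic_char_dot_loc_const xi.
exact: (lc_integrableM gi chik (fun x => l1norm_padic_char x xi)).
Qed.

Lemma l1norm_fourier g xi : lc_integrable mu g ->
  ((l1norm (fourier g xi))%:E <= 2%:E * L1norm mu g)%E.
Proof.
move=> gi; have gchi := lc_integrable_char xi gi.
apply: le_trans (l1norm_complex_integral (lc_integrable_complex gchi)) _.
have [[k gk] _] := gi; have [[l gl] _] := gchi.
apply: L1norm_le gk gl _ => // x; rewrite (le_trans (l1normM _ _)) // mulrC.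
by rewrite ler_wpM2r ?l1norm_ge0 // l1norm_padic_char.
Qed.

Lemma fourierD g h xi : lc_integrable mu g -> lc_integrable mu h ->
  fourier (fun x => g x + h x) xi = fourier g xi + fourier h xi.
Proof.
move=> gi hi; rewrite /padic_fourier.
rewrite -complex_integralD; try exact/lc_integrable_complex/lc_integrable_char.
by congr complex_integral; apply/funext => x; rewrite mulrDl.
Qed.

Lemma fourierZ c g xi : lc_integrable mu g ->
  fourier (fun x => c * g x) xi = c * fourier g xi.
Proof.
move=> gi; rewrite /padic_fourier.
rewrite -complex_integralZ; last exact/lc_integrable_complex/lc_integrable_char.
by congr complex_integral; apply/funext => x; rewrite mulrA.
Qed.

Let mulrAC' (c u v : R[i]) : c * (u * v) = u * (v * c).
Proof. by rewrite mulrCA [c * v]mulrC. Qed.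

(** The character is multiplicative, so the factor at [y] turns the integrand into the product of
    [g] and the character, translated by [y]. *)
Lemma fourier_translate g xi y : lc_integrable mu g ->
  fourier (fun x => g (x + y)) xi * padic_char R (padic_dot y xi) = fourier g xi.
Proof.
move=> gi; have gyi := lc_integrable_translate mu_haar y gi.
rewrite /padic_fourier mulrC.
rewrite -complex_integralZ; last exact/lc_integrable_complex/lc_integrable_char.
have [[k gk] _] := lc_integrable_char xi gi.
rewrite -(complex_integral_translate mu_haar y gk); congr complex_integral.
apply/funext => x.
exact: etrans (mulrAC' _ _ _) (congr1 (fun z => g (x + y) * z) (esym (padic_char_dotD x y xi))).
Qed.

(** Translation by [y] in p^k Z_p^n fixes [g], so the transform at [xi] equals itself times the
    character value at [y]; for |xi| > p^k some such [y] makes this factor differ from 1. *)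
Lemma fourier_loc_const_eq0 k g xi : lc_integrable mu g -> loc_const k g ->
  p%:Q ^ k < padic_vec_norm xi -> fourier g xi = 0.
Proof.
move=> gi gk /padic_dot_gt1_exists[y yk y_gt1].
have := fourier_translate xi y gi.
rewrite (_ : (fun x => g (x + y)) = g); last first.
  by apply/funext => x; apply: gk; rewrite padic_ballDl.
move/eqP; rewrite -subr_eq0 -[X in _ - X]mulr1 -mulrBr mulf_eq0 subr_eq0.
by rewrite padic_char_eq1 leNgt y_gt1 orbF => /eqP.
Qed.

(** For [g] of level [k + 1] this is the mean over the ball of [x] of level [k]; as a finite sum of
    translates it can be integrated term by term. *)
Definition digit_avg k g x : R[i] :=
  ((p%:R ^+ n)^-1)%:C%C * \sum_(a : digits) g (x + lower_shift p_pr a k).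

Let pn_gt0 : 0 < p%:R ^+ n :> R.
Proof. by rewrite exprn_gt0 // ltr0n prime_gt0. Qed.

Lemma card_digits : #|{: digits}| = (p ^ n)%N.
Proof. by rewrite card_ffun !card_ord. Qed.

Lemma digit_avg_cst k c x : digit_avg k (fun=> c) x = c.
Proof.
rewrite /digit_avg sumr_const card_digits -[X in _ * X]mulr_natl mulrA natrX.
rewrite rmorphV ?unitfE ?gt_eqF // rmorphXn /= rmorph_nat mulVf ?mul1r //.
by rewrite expf_neq0 // pnatr_eq0 -lt0n prime_gt0.
Qed.

Lemma digit_avg_loc_const_id k g x : loc_const k g -> digit_avg k g x = g x.
Proof.
move=> gk; rewrite -[RHS](digit_avg_cst k (g x) x); congr (_ * _).
apply: eq_bigr => a _; apply: gk; rewrite padic_ballDl; exact: lower_shift_ball.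
Qed.

Lemma digit_avg_lincomb k (c d : R[i]) g h x :
  digit_avg k (fun x => c * g x + d * h x) x = c * digit_avg k g x + d * digit_avg k h x.
Proof. by rewrite /digit_avg big_split /= -!mulr_sumr mulrDr !(mulrCA _ c) !(mulrCA _ d). Qed.

Lemma l1norm_digit_avg_lt k g x (d : R) :
  (forall a, l1norm (g (x + lower_shift p_pr a k)) < d) -> l1norm (digit_avg k g x) < d.
Proof.
move=> g_lt; rewrite /digit_avg l1normZ ger0_norm ?invr_ge0 ?ltW //.
rewrite mulrC ltr_pdivrMr // mulrC -natrX -card_digits mulr_natl -sumr_const.
apply: le_lt_trans (l1norm_sum _) _; apply: ltr_sum => [|a _]; last exact: g_lt.
(* The strict comparison of sums asks for at least one index: the zero digit vector. *)
by apply/hasP; exists [ffun=> Ordinal (prime_gt0 p_pr)].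
Qed.

Lemma digit_avg_loc_const k l g : loc_const l g -> loc_const l (digit_avg k g).
Proof.
move=> gl x y xy; congr (_ * _); apply: eq_bigr => a _; apply: gl.
by rewrite padic_ballD.
Qed.

(** By invariance all p^n translates have the norm of [g], and the factor p^-n compensates for their
    number. *)
Lemma L1norm_digit_avg k g : lc_integrable mu g -> (L1norm mu (digit_avg k g) <= L1norm mu g)%E.
Proof.
move=> [[l gl] goo].
pose S (s : seq digits) x := \sum_(a <- s) g (x + lower_shift p_pr a k).
have Sl s : loc_const l (S s).
  by move=> x y xy; apply: eq_bigr => a _; apply: gl; rewrite padic_ballD.
have Sle s : (L1norm mu (S s) <= (size s)%:R%:E * L1norm mu g)%E.
  elim: s => [|a s IHs].
    have := @L1norm_le _ _ _ _ mu l l 0 g (S [::]) (lexx _) gl (Sl _).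
    by apply=> x; rewrite /S big_nil l1norm0 mul0r.
  have gal : loc_const l (fun x => g (x + lower_shift p_pr a k)).
    exact: loc_const_translate.
  apply: (@le_trans _ _ (1%:E * L1norm mu g + 1%:E * L1norm mu (S s))%E).
    rewrite -(L1norm_translate mu_haar (lower_shift p_pr a k) gl).
    apply: L1norm_le_lincomb gal (Sl s) (Sl _) _ => // x.
    by rewrite !mul1r /S big_cons l1normD.
  rewrite !mul1e /= -natr1 EFinD addeC ge0_muleDl ?lee_fin // mul1e.
  exact: leeD2l.
have -> : digit_avg k g = (fun x => ((p%:R ^+ n)^-1)%:C%C * S (enum {: digits}) x).
  by apply/funext => x; rewrite /digit_avg /S big_enum.
have N0 : 0 <= (p%:R ^+ n)^-1 :> R by rewrite invr_ge0 ltW.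
apply: (@le_trans _ _ ((p%:R ^+ n)^-1%:E * L1norm mu (S (enum {: digits})))%E).
  apply: L1norm_le (Sl (enum {: digits})) (loc_const_comp (fun z => _ * z) (Sl _)) _ => // x.
  by rewrite l1normZ ger0_norm.
apply: le_trans (lee_wpmul2l _ (Sle _)) _; first by rewrite lee_fin.
by rewrite -cardE card_digits natrX muleA -EFinM mulVf ?gt_eqF // mul1e.
Qed.

Lemma lc_integrable_digit_avg k g : lc_integrable mu g -> lc_integrable mu (digit_avg k g).
Proof.
move=> gi; split; last exact: le_lt_trans (L1norm_digit_avg k gi) gi.2.
by have [[l gl] _] := gi; exists l; exact: digit_avg_loc_const.
Qed.

Lemma lc_integrable0 : lc_integrable mu (fun=> 0).
Proof.
split; first by exists 0.
rewrite /L1norm; under eq_integral do rewrite l1norm0.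
by rewrite integral0.
Qed.

Lemma fourier_sum (I : finType) (F : I -> Qpn -> R[i]) xi :
  (forall i, lc_integrable mu (F i)) ->
  fourier (fun x => \sum_i F i x) xi = \sum_i fourier (F i) xi.
Proof.
move=> Fi.
suff [_ ->] : lc_integrable mu (fun x => \sum_i F i x) /\
    fourier (fun x => \sum_i F i x) xi = \sum_i fourier (F i) xi by [].
have -> : (fun x => \sum_i F i x) = \sum_i F i by apply/funext => x; rewrite fct_sumE.
elim/big_ind2: _ => [|g c h d [gi gE] [hi hE]|//].
  split; first exact: lc_integrable0.
  rewrite -[LHS]/(fourier (fun=> 0) xi).
  have -> : (fun=> 0) = (fun x => 0 * (fun=> 0) x) :> (Qpn -> R[i]).
    by apply/funext => x; rewrite mul0r.
  by rewrite fourierZ ?mul0r //; exact: lc_integrable0.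
by split; [exact: lc_integrableD | rewrite -gE -hE -fourierD].
Qed.

(** The shifts lie in p^k Z_p^n, where the character of such a [xi] is trivial, so each translate
    has the same transform as [g]. *)
Lemma fourier_digit_avg k g xi : lc_integrable mu g -> padic_vec_norm xi <= p%:Q ^ k ->
  fourier (digit_avg k g) xi = fourier g xi.
Proof.
move=> gi xik; have gai a := lc_integrable_translate mu_haar (lower_shift p_pr a k) gi.
rewrite fourierZ; last exact: lc_integrable_sum lc_integrable0 gai.
rewrite fourier_sum // -[RHS](digit_avg_cst k (fourier g xi) 0); congr (_ * _).
apply: eq_bigr => a _; rewrite -[RHS](fourier_translate xi (lower_shift p_pr a k) gi).
rewrite (@padic_char_dot_eq1 _ _ k) ?mulr1 //; exact: lower_shift_ball.
Qed.

(** Compactness of the support extracts finitely many centres from the balls on which [f] is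
    constant. *)
Lemma schwartz_bruhat_cover (f : Qpn -> R[i]) : schwartz_bruhat f ->
  exists (D : seq Qpn) (k : Qpn -> nat),
    (forall x y, padic_ball x (k x) y -> f y = f x) /\
    (forall x, f x != 0 -> exists2 y, y \in D & padic_ball y (k y) x).
Proof.
move=> [f_loc f_cpt].
have /choice[k kf] x : exists k : nat, padic_ball x k `<=` [set y | f y = f x].
  by apply/nbhs_padicP; exact: f_loc.
move: f_cpt; rewrite compact_cover => /(_ Qpn setT (fun x => padic_ball x (k x))).
case=> [x _|x _|D _ DK]; first exact: open_padic_ball.
  by exists x => //; exact: padic_ball_refl.
exists (finmap.enum_fset D), k; split=> // x fx0; have [] := DK x; first exact: subset_closure.
by move=> y /= yD xy; exists y.
Qed.

(** The largest level of the finite cover works at points where [f] is nonzero; if [f x] vanishes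
    and [f y] does not, the symmetry of balls exchanges the two points. *)
Lemma schwartz_bruhat_loc_const (f : Qpn -> R[i]) : schwartz_bruhat f ->
  exists k : nat, loc_const k f.
Proof.
move=> /schwartz_bruhat_cover[D [k [kf DK]]].
exists (\max_(y <- D) k y)%N.
have nonzero x y : padic_ball x (\max_(y <- D) k y)%N y -> f x != 0 -> f y = f x.
  move=> xy /DK[z zD zx]; rewrite (kf z x zx); apply: kf.
  apply: padic_ball_trans zx _; apply: padic_ball_le xy.
  by rewrite lez_nat; exact: leq_bigmax_seq.
move=> x y xy; have [fx0|] := eqVneq (f x) 0; last exact: nonzero.
have [->|fy0] := eqVneq (f y) 0; first by rewrite fx0.
exact: (esym (nonzero y x (padic_ball_sym xy) fy0)).
Qed.

Lemma haar_ball_le1 x (k : nat) : (mu (padic_ball x k) <= 1)%E.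
Proof.
have mball y (l : int) : measurable (padic_ball y l : set T).
  by apply: open_measurable_padic; exact: open_padic_ball.
have -> : padic_ball x k = [set x + y | y in padic_ball 0 k].
  apply/seteqP; split=> [y xy|_ [y yk <-]]; last by rewrite /= padic_ballDl.
  by exists (y - x); [rewrite /= -(padic_ballDl x) subrKC|exact: subrKC].
rewrite mu_haar.1 //; rewrite -mu_haar.2; apply: le_measure; rewrite ?inE //.
  rewrite (_ : [set _ | _] = padic_ball 0 0) //.
  by apply/seteqP; split=> y; rewrite /padic_ball /= subr0.
move=> y /(@padic_ball_le _ _ _ _ _ 0) h; have := h isT.
by rewrite /padic_ball /= subr0.
Qed.

(** The integrand is dominated by the finite sum of the indicators of the covering balls weighted by
    [l1norm (f y)]; these balls have mass at most 1, their levels being nonnegative. *)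
Lemma schwartz_bruhat_integrable (f : Qpn -> R[i]) : schwartz_bruhat f -> lc_integrable mu f.
Proof.
move=> f_sb; have [l fl] := schwartz_bruhat_loc_const f_sb.
split; first by exists l.
have [D [k [kf DK]]] := schwartz_bruhat_cover f_sb.
have mball y : measurable (padic_ball y (k y) : set T).
  by apply: open_measurable_padic; exact: open_padic_ball.
pose F y (x : T) : \bar R := ((l1norm (f y))%:E * (\1_(padic_ball y (k y)) x)%:E)%E.
have F0 y x : (0 <= F y x)%E by rewrite mule_ge0 ?lee_fin ?l1norm_ge0.
have mF y : measurable_fun setT (F y).
  by apply: measurable_funeM; apply/measurable_EFinP; exact: measurable_indic.
apply: (@le_lt_trans _ _ (\int[mu]_x (\sum_(y <- D) F y x))%E).
  apply: ge0_le_integral => //.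
  - by move=> x _; rewrite lee_fin l1norm_ge0.
  - apply: (@loc_const_measurable _ _ _ _ _ l); exact: (loc_const_comp (fun z => (l1norm z)%:E)).
  - exact: emeasurable_sum.
  move=> x _; have [->|/DK[y yD yx]] := eqVneq (f x) 0.
    by rewrite l1norm0 sume_ge0.
  rewrite (big_rem y) //= -[leLHS]adde0 leeD ?sume_ge0 // /F (kf y x yx).
  by rewrite indicE mem_set //= mule1.
rewrite ge0_integral_sum //.
elim/big_ind: _ => [|? ? h1 h2|y _]; first exact: ltry.
  exact: lte_add_pinfty.
rewrite ge0_integralZl_EFin ?l1norm_ge0 //.
- rewrite integral_indic // setIT lte_mul_pinfty ?lee_fin ?l1norm_ge0 //.
  exact: le_lt_trans (haar_ball_le1 y (k y)) (ltry 1).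
- by apply/measurable_EFinP; exact: measurable_indic.
Qed.

End FourierOfLocallyConstant.

(** * Harmonic functions on the tree *)

Section Tree.
Variables (p : nat) (p_pr : prime p) (n : nat).
Local Notation Qpn := 'rV[padic p_pr]_n.
Local Notation digits := {ffun 'I_n -> 'I_p}.
Implicit Types (x y : Qpn) (k l : int).

Lemma vtx_eq x y k l : vtx x k = vtx y l <-> k = l /\ padic_ball x k y.
Proof.
rewrite /vtx; split=> [/eqquotP /andP[/= /eqP -> xy]|[<- xy]].
  by split=> //; exact: padic_ball_sym.
by apply/eqquotP/andP; split=> /=; [exact: eqxx|exact: padic_ball_sym].
Qed.

Lemma level_vtx x k : level (vtx x k) = k.
Proof.
rewrite /level; have : vtx (repr (vtx x k)).1 (repr (vtx x k)).2 = vtx x k.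
  by rewrite /vtx -surjective_pairing reprK.
by case/vtx_eq.
Qed.

Definition neighbor_seq x k : seq (vertex p_pr n) :=
  vtx x (k - 1) :: [seq vtx (x + lower_shift p_pr a k) (k + 1) | a <- enum {: digits}].

Lemma neighbor_seq_uniq x k : uniq (neighbor_seq x k).
Proof.
rewrite /= map_inj_uniq ?enum_uniq ?andbT.
  by apply/mapP => -[a _ /(congr1 (@level _ _ _))]; rewrite !level_vtx; lia.
by move=> a b /vtx_eq[_ /lower_shift_inj].
Qed.

(** [neighbors] ranges over all representatives of the vertex; another representative gives the same
    upper neighbor and only relabels the lower ones. *)
Lemma neighborsE x k : neighbors (vtx x k) = [set` neighbor_seq x k].
Proof.
apply/seteqP; split=> [u [y [l [/vtx_eq[<- xy] u_nb]]]|u /=]; last first.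
  rewrite inE => /predU1P[->|/mapP[a _ ->]]; exists x, k; split=> //; first by left.
  by right; exists a.
rewrite /= inE; case: u_nb => [->|[a ->]]; apply/predU1P; [left|right].
  apply/vtx_eq; split; first by [].
  by apply/padic_ball_sym; apply: padic_ball_le xy; lia.
have [b xb] : exists b, padic_ball (x + lower_shift p_pr b k) (k + 1) (y + lower_shift p_pr a k).
  apply: lower_shift_exists; apply: padic_ball_trans xy _.
  by rewrite padic_ballDl; exact: lower_shift_ball.
apply/mapP; exists b; first by rewrite mem_enum.
apply/vtx_eq; exact: conj erefl (padic_ball_sym xb).
Qed.

(** Lets continuity at a finite end be tested along the ray descending to it: a basic neighborhood
    is a finite intersection of half-trees and complements of half-trees, each of which contains a
    tail of the ray. *)
Lemma nbhs_finite_end x (A : set (end_compactification p_pr n)) :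
  nbhs (FiniteEnd x : end_compactification p_pr n) A ->
  exists K : int, forall k, K <= k -> A (Vertex (vtx x k)).
Proof.
rewrite nbhsE => -[B [Bop Bx] BA].
have [D' D'sub DB] := Bop.
have : (\bigcup_(i in D') id i) (FiniteEnd x : end_compactification p_pr n).
  by rewrite DB.
case=> U D'U Ux; have [E' E'sub EU] := D'sub _ D'U.
have half_tree_tail (V : set (end_compactification p_pr n)) :
    V (FiniteEnd x) ->
    (exists y l, V = lower_half_tree y l \/ V = ~` lower_half_tree y l) ->
    exists K : int, forall k, K <= k -> V (Vertex (vtx x k)).
  move=> Vx [y [l VE]]; move: Vx; case: VE => -> yx; exists l => k lk.
    by exists x; [exact: yx|exists k].
  (* If (x, k) with k >= l lay in the excluded half-tree, its ball, which contains [x], would lie in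
     the ball of [y] of level [l]. *)
  move=> [z yz [m lm /vtx_eq[kE xz]]]; apply: yx.
  apply: padic_ball_trans yz _; apply/padic_ball_sym.
  exact: padic_ball_le lk _ xz.
have tails (s : seq (set (end_compactification p_pr n))) :
    (forall V, V \in s -> V (FiniteEnd x)) ->
    (forall V, V \in s ->
      exists y l, V = lower_half_tree y l \/ V = ~` lower_half_tree y l) ->
    exists K : int, forall V, V \in s -> forall k, K <= k -> V (Vertex (vtx x k)).
  elim: s => [|V s IHs] sx sb; first by exists 0.
  have [V' V's|V' V's|K sK] := IHs.
  - by apply: sx; rewrite inE V's orbT.
  - by apply: sb; rewrite inE V's orbT.
  have [K' VK'] := half_tree_tail V (sx V (mem_head _ _)) (sb V (mem_head _ _)).
  exists (Num.max K K') => W; rewrite inE => WVs k; rewrite ge_max => /andP[Kk K'k].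
  by case/predU1P: WVs => [->|/sK]; [exact: VK'|exact].
have [V VE|V VE|K EK] := tails (finmap.enum_fset E').
- by move: Ux; rewrite -EU; apply.
- exact: set_mem (E'sub _ VE).
exists K => k Kk; apply: BA; rewrite -DB.
have UV : U (Vertex (vtx x k)) by rewrite -EU => V VE; exact: EK VE _ Kk.
by exists U.
Qed.

End Tree.

(** * The layers of a solution of the Dirichlet problem *)

Section Harmonic.
Variables (R : realType) (p : nat) (p_pr : prime p) (n : nat) (s : R).
Local Notation Qpn := 'rV[padic p_pr]_n.
Variables (f : Qpn -> R[i]) (phi : vertex p_pr n -> R[i]).
Hypothesis phi_sol : dirichlet_solution s f phi.
Local Notation phi_ k := (layer phi k).
Local Notation digits := {ffun 'I_n -> 'I_p}.
Implicit Types (x y : Qpn) (k l : int).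

Lemma layer_loc_const k : loc_const k (phi_ k).
Proof. by move=> x y xy; congr phi; apply/vtx_eq; exact: conj erefl (padic_ball_sym xy). Qed.

Lemma l1norm_le_norm (z : R[i]) (e : R) : `|z| <= e%:C%C -> l1norm z <= 2 * e.
Proof.
rewrite normc_def lecR => ze.
have Re_le : `|complex.Re z| <= e.
  by rewrite -sqrtr_sqr (le_trans _ ze) // ler_wsqrtr // lerDl sqr_ge0.
have Im_le : `|complex.Im z| <= e.
  by rewrite -sqrtr_sqr (le_trans _ ze) // ler_wsqrtr // lerDr sqr_ge0.
by rewrite mulr_natl mulr2n lerD.
Qed.

Lemma layer_bounded : exists M : R, forall k x, l1norm (phi_ k x) <= M.
Proof.
have [M phiM] := dirichlet_bounded phi_sol.
by exists (2 * M) => k x; apply: l1norm_le_norm; exact: phiM.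
Qed.

Lemma layer_cvg x (e : R) : 0 < e -> 
  exists K : int, forall k, K <= k -> l1norm (phi_ k x - f x) < e.
Proof.
move=> e0.
(* A modulus below e / 3 gives [l1norm] at most 2 e / 3, which is less than e. *)
have e3 : 0 < (e / 3)%:C%C :> R[i] by rewrite ltcR divr_gt0.
have /cvgrPdist_lt/(_ _ e3) /nbhs_finite_end [K HK] :=
  dirichlet_continuous phi_sol (x := FiniteEnd x).
exists K => k Kk; have /ltW/l1norm_le_norm := HK k Kk.
rewrite -l1normN opprB => /le_lt_trans; apply; lra.
Qed.

(** With [w] the weight of the upper edge at (x, k), each lower edge weighs w p^s p^-n; dividing the
    Laplace equation by [w] turns the sum over the children into an average. *)
Lemma layer_harmonic k x :
  phi_ k x - phi_ (k - 1) x =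
  (p%:R `^ s)%:C%C * (digit_avg k (phi_ (k + 1)) x - phi_ k x).
Proof.
set w := p%:R `^ (k%:~R * (s - n%:R)).
have p_gt0 : 0 < p%:R :> R by rewrite ltr0n prime_gt0.
have w0 : w%:C%C != 0 :> R[i] by rewrite (fmorph_eq0 (real_complex R)) gt_eqF ?powR_gt0.
have w_next : p%:R `^ ((k + 1)%:~R * (s - n%:R)) = w * p%:R `^ s * (p%:R ^+ n)^-1 :> R.
  have powRDp r t : p%:R `^ (r + t) = p%:R `^ r * p%:R `^ t :> R.
    by rewrite powRD // (gt_eqF p_gt0) implybT.
  by rewrite intrD mulrDl mul1r -powR_mulrn ?ltW // -powRN powRDp -mulrA -[in RHS]powRDp.
have : w%:C%C * (phi_ (k - 1) x - phi_ k x) + \sum_(a : digits)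
    (w * p%:R `^ s * (p%:R ^+ n)^-1)%:C%C *
    (phi_ (k + 1) (x + lower_shift p_pr a k) - phi_ k x) = 0.
  rewrite -[RHS](dirichlet_harmonic phi_sol (vtx x k)) /laplacian neighborsE.
  rewrite -fsbig_seq ?neighbor_seq_uniq // /neighbor_seq big_cons big_map.
  rewrite /edge_weight !level_vtx; congr (_ + _).
    by rewrite (_ : Order.max (k - 1) k = k) //; lia.
  rewrite [RHS]big_enum; apply: eq_bigr => a _.
  by rewrite level_vtx (_ : Num.max (k + 1) k = k + 1) ?w_next //; lia.
rewrite -mulr_sumr 2!rmorphM /= -!mulrA -mulrDr => /eqP.
rewrite mulf_eq0 (negbTE w0) /= addr_eq0 => /eqP avgE.
rewrite -[LHS]opprB avgE opprK; congr (_ * _).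
rewrite -[X in _ = _ - X](digit_avg_cst k (phi_ k x) x) /digit_avg -mulrBr -sumrB.
by [].
Qed.

End Harmonic.

(** * Solutions as combinations of averages of the boundary values *)

(** Serves for uniqueness of the bounded solution of a recursion that contracts by [q]: let N tend
    to infinity. *)
Lemma geometric_bound_eq0 (R : realType) (q C a : R) : 0 < q < 1 ->
  0 <= a -> (forall N : nat, a <= q ^+ N * C) -> a = 0.
Proof.
move=> /andP[q0 q1] a0 aC; apply: contraTeq isT => a_neq0.
have a_gt0 : 0 < a by rewrite lt_neqAle eq_sym a_neq0.
have : (q ^+ N * C) @[N --> \oo] --> (0 * C : R).
  by apply: cvgMl; apply: cvg_expr; rewrite ger0_norm // ltW.
rewrite mul0r => /cvgrPdist_lt/(_ _ a_gt0)[N _ /(_ N (leqnn _))] /=.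
rewrite sub0r normrN => /(le_lt_trans (ler_norm _)).
by rewrite ltNge aC.
Qed.

Section Martingale.
Variables (R : realType) (p : nat) (p_pr : prime p) (n : nat) (s : R).
Hypothesis s_gt0 : 0 < s.
Local Notation Qpn := 'rV[padic p_pr]_n.
Variables (f : Qpn -> R[i]) (phi : vertex p_pr n -> R[i]).
Hypothesis phi_sol : dirichlet_solution s f phi.
Local Notation phi_ k := (layer phi k).
Local Notation digits := {ffun 'I_n -> 'I_p}.
Implicit Types (x y : Qpn) (k l : int).

Definition harmonic_ratio : R := p%:R `^ (- s).
Local Notation q := harmonic_ratio.

Lemma harmonic_ratio_gt0 : 0 < q.
Proof. by rewrite powR_gt0 // ltr0n prime_gt0. Qed.

Lemma harmonic_ratio_lt1 : q < 1.
Proof.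
have one_powR : 1 `^ s = 1 :> R by rewrite powR1.
rewrite /q powRN invf_lt1 ?powR_gt0 ?ltr0n ?prime_gt0 // -[X in X < _]one_powR.
by rewrite gt0_ltr_powR ?nnegrE ?ler0n ?ltr1n ?prime_gt1.
Qed.

Let q1_neq0 : 1 - q != 0.
Proof. by rewrite subr_eq0 gt_eqF // harmonic_ratio_lt1. Qed.

Let c : R := q / (1 - q).

Let c_ge0 : 0 <= c.
Proof.
by rewrite divr_ge0 ?subr_ge0 // ltW ?harmonic_ratio_gt0 ?harmonic_ratio_lt1.
Qed.

(* The limit of the averages of [phi_ l] over the ball of [x] of level [k], as
   [l] tends to infinity: the increments of [phi] shrink by the factor [q]. *)
Definition boundary_martingale k x : R[i] :=
  phi_ k x + c%:C%C * (phi_ k x - phi_ (k - 1) x).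
Local Notation G := boundary_martingale.

(** Since (1 - q) c = q, multiplying the definition of [G] by 1 - q leaves phi_k - q phi_{k-1}. *)
Lemma layer_martingale k x :
  phi_ k x = (1 - q)%:C%C * G k x + q%:C%C * phi_ (k - 1) x.
Proof.
rewrite /G mulrDr mulrA -rmorphM /= /c mulrCA mulfV // mulr1 rmorphB rmorph1.
ring.
Qed.

Lemma boundary_martingale_loc_const k : loc_const k (G k).
Proof.
move=> x y xy; rewrite /G (layer_loc_const phi xy); congr (_ + _ * (_ - _)).
by apply: (layer_loc_const phi (k := k - 1)); apply: padic_ball_le xy; rewrite gerBl.
Qed.

(** Put u_k = phi_k - phi_{k-1}. By harmonicity the average of phi_{k+1} is phi_k + q u_k; as
    G_{k+1} = (1 + c) phi_{k+1} - c phi_k and (1 + c) q = c, the average of G_{k+1} is phi_k + c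
    u_k. *)
Lemma digit_avg_boundary_martingale k x : digit_avg k (G (k + 1)) x = G k x.
Proof.
have avg_phi : digit_avg k (phi_ (k + 1)) x = phi_ k x + q%:C%C * (phi_ k x - phi_ (k - 1) x).
  rewrite (layer_harmonic phi_sol) mulrA -rmorphM /= -powRD ?addNr ?powRr0 ?rmorph1 ?mul1r ?subrKC //.
  by rewrite pnatr_eq0 -lt0n prime_gt0 ?implybT.
rewrite (_ : G (k + 1) = (fun x => (1 + c)%:C%C * phi_ (k + 1) x + (- c)%:C%C * phi_ k x)).
  rewrite digit_avg_lincomb avg_phi (digit_avg_loc_const_id _ (@layer_loc_const _ _ _ _ phi k)).
  have qc : (1 + c) * q = c by rewrite /c; field.
  rewrite mulrDr mulrA -rmorphM /= qc rmorphD rmorph1 rmorphN /= /G; ring.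
by apply/funext => y; rewrite /G addrK rmorphD rmorph1 rmorphN /=; ring.
Qed.

Lemma boundary_martingale_cvg x (e : R) : 0 < e ->
  exists K : int, forall k, K <= k -> l1norm (G k x - f x) < e.
Proof.
move=> e0; have c1_gt0 : 0 < 1 + 2 * c by rewrite ltr_pwDl // mulr_ge0.
(* The error of [G] is at most that of phi_k plus [c] times the errors of phi_k and phi_{k-1},
   whence the divisor 1 + 2 c, and the threshold [K + 1] to cover level k - 1. *)
have [K HK] := layer_cvg phi_sol x (divr_gt0 e0 c1_gt0).
exists (K + 1) => k Kk; have h1 := HK k; have h2 := HK (k - 1).
have -> : G k x - f x = (phi_ k x - f x) + c%:C%C * ((phi_ k x - f x) - (phi_ (k - 1) x - f x)).
  by rewrite /G; ring.
set d := e / (1 + 2 * c) in h1 h2.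
have -> : e = d + c * (d + d) by rewrite /d; field; rewrite gt_eqF.
apply: le_lt_trans (l1normD _ _) _; rewrite l1normZ ger0_norm //.
apply: ltr_leD; first by apply: h1; lia.
rewrite ler_wpM2l //; apply: le_trans (l1normD _ _) _; rewrite l1normN.
by apply: lerD; apply/ltW; [apply: h1|apply: h2]; lia.
Qed.

(* If [G k x] were at distance [d > 0] from [f x], some child of [(x, k)] would be
   at distance at least [d] too, hence so would a whole ray: impossible at its end. *)
Lemma boundary_martingale_eq (L : int) k x : loc_const L f -> L <= k -> G k x = f x.
Proof.
move=> fL Lk; apply/eqP; rewrite -subr_eq0; apply/eqP/l1norm_eq0.
set d := l1norm _; apply/eqP; apply: contraT => d0.
have {d0} d_gt0 : 0 < d by rewrite lt_neqAle eq_sym d0 l1norm_ge0.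
pose far l y := d <= l1norm (G l y - f y).
have child l y : exists a, L <= l -> far l y -> far (l + 1) (y + lower_shift p_pr a l).
  apply: contrapT => /forallNP no_child.
  have [a0] : inhabited digits by constructor; exact: [ffun=> Ordinal (prime_gt0 p_pr)].
  have /not_implyP[Ll /not_implyP[lfar _]] := no_child a0.
  move: lfar; rewrite /far leNgt => /negP; apply.
  (* If every child were closer than [d], so would be their average; but [G l] is the average of
     [G (l + 1)], and [f] is its own average since l >= L. *)
  rewrite -digit_avg_boundary_martingale.
  rewrite -(digit_avg_loc_const_id y (loc_const_le Ll fL)).
  have := digit_avg_lincomb l 1 (-1) (G (l + 1)) f y; rewrite !mul1r !mulN1r => <-.
  apply: l1norm_digit_avg_lt => a; rewrite mul1r mulN1r ltNge.
  by apply/negP => far_a; apply: (no_child a).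
have /choice[A1 A1P] : forall l, exists A, forall y,
    L <= l -> far l y -> far (l + 1) (y + lower_shift p_pr (A y) l).
  by move=> l; have [A AP] := choice (child l); exists A.
pose path := fix path (m : nat) : Qpn := if m is m'.+1 then
  path m' + lower_shift p_pr (A1 (k + m'%:Z) (path m')) (k + m'%:Z) else x.
have path_far m : far (k + m%:Z) (path m).
  elim: m => [|m IHm]; first by rewrite addr0; exact: lexx.
  by rewrite -addn1 PoszD addrA addn1; apply: A1P => //; lia.
have [y yP] := digit_path_converges x k (fun m => A1 (k + m%:Z) (path m)).
have pathE m : digit_path x k (fun m => A1 (k + m%:Z) (path m)) m = path m.
  by elim: m => //= m ->.
have [K HK] := boundary_martingale_cvg y d_gt0.
pose m := `|K - k|%N.
have := path_far m; rewrite /far leNgt => /negP[].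
have ym := yP m; rewrite pathE in ym.
(* The vertex at depth [m] contains the end [y] and has level at least [L], so [G] and [f] may be
   evaluated at [y], where they are already closer than [d]. *)
rewrite (boundary_martingale_loc_const ym) (fL y) ?HK //; first by rewrite /m; lia.
by apply: padic_ball_le ym; lia.
Qed.

End Martingale.

(** * Fourier transforms of the layers *)

Section LayerFourier.
Variables (R : realType) (p : nat) (p_pr : prime p) (n : nat) (s : R).
Hypothesis s_gt0 : 0 < s.
Local Notation Qpn := 'rV[padic p_pr]_n.
Variable mu : {measure set (padic_borel p_pr n) -> \bar R}.
Hypothesis mu_haar : normalized_haar mu.
Variables (f : Qpn -> R[i]) (phi : vertex p_pr n -> R[i]).
Hypothesis f_sb : schwartz_bruhat f.
Hypothesis phi_sol : dirichlet_solution s f phi.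
Local Notation phi_ k := (layer phi k).
Local Notation q := (harmonic_ratio p s).
Local Notation G := (boundary_martingale s phi).
Local Notation fourier := (padic_fourier mu).
Implicit Types (x y xi : Qpn) (k l : int).

Let q_gt0 : 0 < q := harmonic_ratio_gt0 p_pr s.
Let q_lt1 : q < 1 := harmonic_ratio_lt1 p_pr s_gt0.

Let f_int : lc_integrable mu f := schwartz_bruhat_integrable mu_haar f_sb.

Let G_loc_const k : loc_const k (G k).
Proof. exact: boundary_martingale_loc_const. Qed.

(** Descending induction from a level [L] of [f], where [G] is [f] itself: averaging does not
    increase the norm and keeps the transform on |xi| <= p^k, while local constancy kills the other
    frequencies. *)
Lemma boundary_martingale_props k :
  [/\ lc_integrable mu (G k), (L1norm mu (G k) <= L1norm mu f)%E &
      forall xi, fourier (G k) xi =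
        if padic_vec_norm xi <= p%:Q ^ k then fourier f xi else 0].
Proof.
have [L fL] := schwartz_bruhat_loc_const f_sb.
have four0 l xi : lc_integrable mu (G l) -> ~~ (padic_vec_norm xi <= p%:Q ^ l) ->
    fourier (G l) xi = 0.
  move=> Gi; rewrite -ltNge.
  exact: (fourier_loc_const_eq0 mu_haar Gi (@G_loc_const l)).
have large l : L%:Z <= l -> G l = f.
  by move=> Ll; apply/funext => x; exact: (boundary_martingale_eq s_gt0 phi_sol _ fL Ll).
pose props l := [/\ lc_integrable mu (G l), (L1norm mu (G l) <= L1norm mu f)%E &
  forall xi, fourier (G l) xi =
    if padic_vec_norm xi <= p%:Q ^ l then fourier f xi else 0].
have props_ge l : L%:Z <= l -> props l.
  (* At these levels the transform of [f] itself vanishes for |xi| > p^l, so that the case formula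
     holds. *)
  move=> Ll; rewrite /props large //; split=> // xi; case: ifPn => // xi_l.
  by rewrite -(large l) // four0 // large.
have below (m : nat) : props (L%:Z - m%:Z).
  elim: m => [|m [Gi Gle Gf]]; first by apply: props_ge; rewrite subr0.
  have mE : L%:Z - m%:Z = L%:Z - m.+1%:Z + 1 by lia.
  rewrite mE in Gi Gle Gf.
  have GE : digit_avg (L%:Z - m.+1%:Z) (G (L%:Z - m.+1%:Z + 1)) = G (L%:Z - m.+1%:Z).
    by apply/funext => x; exact: (digit_avg_boundary_martingale s_gt0 phi_sol).
  have Gi' : lc_integrable mu (G (L%:Z - m.+1%:Z)).
    by rewrite -GE; exact: lc_integrable_digit_avg.
  split=> // [|xi].
    by rewrite -GE; apply: le_trans (L1norm_digit_avg mu_haar _ Gi) Gle.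
  case: ifPn => xi_m; last exact: four0.
  rewrite -GE fourier_digit_avg // Gf (le_trans xi_m) // ler_padic_base_exp //; lia.
have [kL|Lk] := leP k L%:Z; last by apply: props_ge; exact: ltW.
by rewrite (_ : k = L%:Z - `|L%:Z - k|%N%:Z); [exact: below|lia].
Qed.

(** The recursion [layer_martingale] unrolled [N] times, with 0 in place of the layer then
    reached. *)
Fixpoint layer_partial (N : nat) k x : R[i] :=
  if N is N'.+1 then (1 - q)%:C%C * G k x + q%:C%C * layer_partial N' (k - 1) x else 0.

Lemma layer_partial_loc_const N k : loc_const k (layer_partial N k).
Proof.
elim: N k => [//|N IHN] k x y xy /=.
rewrite (G_loc_const xy) (IHN (k - 1) x y) //.
by apply: padic_ball_le xy; lia.
Qed.

(** The weights 1 - q and q add up to 1, so the bound on the norms of [G] passes through the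
    recursion. *)
Lemma L1norm_layer_partial N k : (L1norm mu (layer_partial N k) <= L1norm mu f)%E.
Proof.
elim: N k => [|N IHN] k.
  rewrite /L1norm /=; under eq_integral do rewrite l1norm0.
  by rewrite integral0; exact: L1norm_ge0.
have [_ Gle _] := boundary_martingale_props k.
apply: (@le_trans _ _ ((1 - q)%:E * L1norm mu (G k) +
    q%:E * L1norm mu (layer_partial N (k - 1)))%E).
  apply: L1norm_le_lincomb (@G_loc_const k)
    (@layer_partial_loc_const N (k - 1)) (@layer_partial_loc_const N.+1 k) _.
  - by rewrite subr_ge0 ltW.
  - exact: ltW.
  move=> x /=; apply: le_trans (l1normD _ _) _.
  by rewrite !l1normZ !ger0_norm ?subr_ge0 // ltW.
apply: (@le_trans _ _ ((1 - q)%:E * L1norm mu f + q%:E * L1norm mu f)%E).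
  by apply: leeD; apply: lee_wpmul2l => //; rewrite lee_fin ?subr_ge0 ltW.
have [q0 q1] : (0 <= q%:E)%E /\ (0 <= (1 - q)%:E)%E by rewrite !lee_fin subr_ge0 !ltW.
by rewrite -ge0_muleDl // -EFinD subrK mul1e.
Qed.

Lemma layer_partial_remainder N k x :
  layer_partial N k x - phi_ k x = - ((q ^+ N)%:C%C * phi_ (k - N%:Z) x).
Proof.
elim: N k => [|N IHN] k; first by rewrite expr0 rmorph1 mul1r subr0 sub0r.
rewrite /= {1}(layer_martingale s_gt0 phi k) exprS rmorphM /= opprD addrACA subrr add0r.
rewrite -mulrBr IHN mulrN mulrA; congr (- (_ * phi (vtx x _))); lia.
Qed.

(** The remainder q^N phi_{k-N} is controlled only in sup norm: the partial sums converge pointwise,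
    not a priori in L^1, hence the use of Fatou's lemma. *)
Lemma L1norm_layer k : (L1norm mu (phi_ k) <= L1norm mu f)%E.
Proof.
apply: (L1norm_fatou (F := fun N => layer_partial N k) (k := fun=> k)) => [N|N|x].
- exact: layer_partial_loc_const.
- exact: L1norm_layer_partial.
have [M phiM] := layer_bounded phi_sol.
have lim0 : (q ^+ N * M) @[N --> \oo] --> (0 : R).
  rewrite -(mul0r M); apply: cvgMl; apply: cvg_expr; rewrite ger0_norm // ltW //.
apply: (@squeeze_cvgr _ _ _ _ (fun=> 0) (fun N => q ^+ N * M)) => //; last exact: cvg_cst.
apply: nearW => N; rewrite l1norm_ge0 /= layer_partial_remainder l1normN l1normZ.
have qN_ge0 : 0 <= q ^+ N by rewrite exprn_ge0 // ltW.
by rewrite ger0_norm // ler_wpM2l.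
Qed.

Lemma lc_integrable_layer k : lc_integrable mu (phi_ k).
Proof.
split; first by exists k; exact: layer_loc_const.
exact: le_lt_trans (L1norm_layer k) f_int.2.
Qed.

(** At [xi = 0] the power of the norm is 0 because s > 0, so the symbol is 1, as the convention of
    the theorem demands. *)
Definition layer_symbol k xi : R :=
  1 - p%:R `^ (- s * (k + 1)%:~R) * ratr (padic_vec_norm xi) `^ s.

(** The defect from 1 is geometric in [k]: this is the recursion of the layers at a frequency where
    [G] has the transform of [f]. *)
Lemma layer_symbol_pred k xi : 1 - layer_symbol k xi = q * (1 - layer_symbol (k - 1) xi).
Proof.
rewrite /layer_symbol !subKr mulrA; congr (_ * _).
rewrite /harmonic_ratio -powRD; last by rewrite pnatr_eq0 -lt0n prime_gt0 ?implybT.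
by congr (_ `^ _); rewrite !intrD; ring.
Qed.

Let ratr_base_exp k : ratr (p%:Q ^ k) = p%:R `^ k%:~R :> R.
Proof. by rewrite powR_intmul ?ler0n // fmorphXz /= ratr_int. Qed.

Let harmonic_ratio_base_exp k :
  p%:R `^ (- s * (k + 1)%:~R) * ratr (p%:Q ^ k) `^ s = q.
Proof.
rewrite ratr_base_exp -powRrM -powRD; last by rewrite pnatr_eq0 -lt0n prime_gt0 ?implybT.
by congr (_ `^ _); rewrite intrD; ring.
Qed.

Lemma layer_symbol_top k xi : padic_vec_norm xi = p%:Q ^ k -> layer_symbol k xi = 1 - q.
Proof. by move=> xiE; rewrite /layer_symbol xiE harmonic_ratio_base_exp. Qed.

Lemma layer_symbol_itv k xi : padic_vec_norm xi <= p%:Q ^ k -> 0 <= layer_symbol k xi <= 1.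
Proof.
move=> xik; rewrite subr_ge0 gerBl mulr_ge0 ?powR_ge0 // andbT.
apply: le_trans (ltW q_lt1); rewrite -(harmonic_ratio_base_exp k).
rewrite ler_wpM2l ?powR_ge0 // ge0_ler_powR ?nnegrE ?ler0q ?ler_rat //.
- exact: ltW.
- by apply/bigmax_geP; left.
- exact: padic_base_exp_ge0.
Qed.

(** Both sides satisfy the transformed recursion of [layer_martingale], so their difference at level
    [k] is [q] times that at level [k - 1]; being bounded in the level, it vanishes. *)
Lemma fourier_layer k xi : fourier (phi_ k) xi =
  if padic_vec_norm xi <= p%:Q ^ k then fourier f xi * (layer_symbol k xi)%:C%C else 0.
Proof.
pose F l := if padic_vec_norm xi <= p%:Q ^ l
  then fourier f xi * (layer_symbol l xi)%:C%C else 0.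
rewrite -[RHS]/(F k).
have F_pred l : F l = (1 - q)%:C%C * (if padic_vec_norm xi <= p%:Q ^ l then fourier f xi else 0) +
    q%:C%C * F (l - 1).
  (* Three cases: |xi| > p^l, where all terms vanish; |xi| = p^l, where the term of level l - 1 is
     still 0 and the symbol is 1 - q; |xi| < p^l, where the symbols recur. *)
  rewrite /F; case: ifPn => xi_l; last first.
    rewrite ifN ?mulr0 ?addr0 //; apply: contra xi_l => /le_trans; apply.
    by rewrite ler_padic_base_exp // gerBl.
  case: ifPn => xi_l1; last first.
    by rewrite (layer_symbol_top (padic_vec_norm_eq_exp xi_l xi_l1)) mulr0 addr0 mulrC.
  have -> : layer_symbol l xi = 1 - q + q * layer_symbol (l - 1) xi.
    by have := layer_symbol_pred l xi; lra.
  by rewrite rmorphD rmorphM /=; ring.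
have h_pred l : fourier (phi_ l) xi = (1 - q)%:C%C *
    (if padic_vec_norm xi <= p%:Q ^ l then fourier f xi else 0) + q%:C%C * fourier (phi_ (l - 1)) xi.
  have [Gi _ <-] := boundary_martingale_props l.
  rewrite -!fourierZ // -?fourierD //; try exact: lc_integrableZ; try exact: lc_integrable_layer.
    by congr padic_fourier; apply/funext => x; exact: layer_martingale.
  by apply: lc_integrableZ; exact: lc_integrable_layer.
(* Independent of the level: the first term bounds the transforms of the layers through their L^1
   norms, the second bounds [F], whose symbol lies in [0, 1]. *)
pose C : R := 2 * fine (L1norm mu f) + l1norm (fourier f xi).
have bounded l : l1norm (fourier (phi_ l) xi - F l) <= C.
  apply: le_trans (l1normD _ _) _; apply: lerD; last first.
    rewrite l1normN /F; case: ifPn => [/layer_symbol_itv/andP[S0 S1]|_]; last first.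
      by rewrite l1norm0 l1norm_ge0.
    by rewrite mulrC l1normZ ger0_norm // ler_piMl // l1norm_ge0.
  rewrite -lee_fin EFinM fineK.
    apply: le_trans (l1norm_fourier xi (lc_integrable_layer l)) _.
    by apply: lee_wpmul2l; [rewrite lee_fin|exact: L1norm_layer].
  by rewrite ge0_fin_numE ?L1norm_ge0 //; exact: f_int.2.
apply/eqP; rewrite -subr_eq0; apply/eqP/l1norm_eq0.
apply: (@geometric_bound_eq0 _ q C); rewrite ?q_gt0 ?l1norm_ge0 // => N.
elim: N k => [|N IHN] l; first by rewrite expr0 mul1r.
rewrite h_pred F_pred opprD addrACA subrr add0r -mulrBr l1normZ.
have q_ge0 := ltW q_gt0.
by rewrite ger0_norm // exprS -mulrA ler_wpM2l.
Qed.

End LayerFourier.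

Theorem theorem4p5 (R : realType) (p : nat) (p_pr : prime p)
    (n : nat) (n_gt0 : (0 < n)%N) (s : R) (s_gt0 : 0 < s)
    (mu : {measure set (padic_borel p_pr n) -> \bar R})
    (mu_haar : normalized_haar mu)
    (f : 'rV[padic p_pr]_n -> R[i]) (f_sb : schwartz_bruhat f)
    (phi : vertex p_pr n -> R[i]) (phi_sol : dirichlet_solution s f phi)
    (k : int) :
  complex_integrable mu (layer phi k) /\
  forall xi : 'rV[padic p_pr]_n,
    padic_fourier mu (layer phi k) xi =
    if (- padic_vec_val xi <= k%:E)%E
    then padic_fourier mu f xi *
      (1 - p%:R `^ (- s * (k + 1)%:~R) * ratr (padic_vec_norm xi) `^ s)%:C%C
    else 0.
Proof.
split; first exact/lc_integrable_complex/(lc_integrable_layer s_gt0 mu_haar f_sb phi_sol).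
by move=> xi; rewrite padic_vec_val_le (fourier_layer s_gt0 mu_haar f_sb phi_sol).
Qed.
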